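(* Let $\eta\colon M\to\Sigma_g$ be a Seifert fibration of an orientable, closed Seifert manifold $M$ with orientable base of genus $g$. The rational holonomy Lie algebra of the group $\pi_\eta=\pi_1(M)$ is given, up to isomorphism of graded Lie algebras, by \[ \mathfrak{h}(\pi_\eta;\mathbb{Q})\cong\begin{cases}\mathfrak{lie}(x_1,y_1,\dots,x_g,y_g,h)\big/\bigl\langle\sum_{i=1}^g[x_i,y_i]=0,\ h\text{ central}\bigr\rangle&\text{if }e(\eta)=0,\\[2pt] \mathfrak{lie}(2g)&\text{if }e(\eta)\ne 0,\end{cases} \] where all generators have degree $1$ and $\mathfrak{lie}(2g)=\mathfrak{lie}(x_1,y_1,\dots,x_g,y_g)$ is the free Lie algebra on $2g$ generators.
   Context: $\mathfrak{lie}(\cdot)$ denotes the free Lie algebra over $\mathbb{Q}$. The manifold $M$ is described by Seifert invariants: the genus $g$ of the base, an integer $b=b(\eta)$, and pairs of coprime integers $(\alpha_1,\beta_1),\dots,(\alpha_s,\beta_s)$ with $\alpha_j\ge2$. Its fundamental group is \[ \pi_\eta=\langle x_1,y_1,\dots,x_g,y_g,z_1,\dots,z_s,h\mid h\text{ central},\ [x_1,y_1]\cdots[x_g,y_g]z_1\cdots z_s=h^b,\ z_i^{\alpha_i}h^{\beta_i}=1\ (i=1,\dots,s)\rangle, \] and the Euler number is $e(\eta)=-b(\eta)-\sum_{i=1}^s\beta_i/\alpha_i$. For a finitely generated group $G$, the holonomy Lie algebra is $\mathfrak{h}(G)=\mathfrak{h}(G;\mathbb{Q})=\mathfrak{lie}(H_1(G;\mathbb{Q}))/\langle\operatorname{im}\mu_G^\vee\rangle$,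 where $\mu_G^\vee\colon H_2(G;\mathbb{Q})\to\bigwedge^2H_1(G;\mathbb{Q})\cong\mathfrak{lie}_2(H_1(G;\mathbb{Q}))$ (with $v\wedge w\leftrightarrow[v,w]$) is the dual of the cup-product map $\mu_G\colon H^1(G;\mathbb{Q})\wedge H^1(G;\mathbb{Q})\to H^2(G;\mathbb{Q})$. *)

(* Defs.v *)
From HB Require Import structures.
From mathcomp Require Import all_boot all_order all_algebra finmap ring.
From mathcomp Require Import boolp classical_sets functions.
From mathcomp.multinomials Require Import monalg.

Set Implicit Arguments.
Unset Strict Implicit.
Unset Printing Implicit Defensive.

Import Order.TTheory GRing.Theory Num.Theory.

Local Open Scope classical_set_scope.
Local Open Scope ring_scope.
Local Open Scope quotient_scope.

Definition is_submod (V : lmodType rat) (W : set V) : Prop :=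
  W 0 /\ forall (a : rat) (u v : V), W u -> W v -> W (a *: u + v).

Definition lspan (V : lmodType rat) (S : set V) : set V :=
  [set x | forall W : set V, is_submod W -> S `<=` W -> W x].

Section Submodules.
Variable V : lmodType rat.
Implicit Types (S W : set V) (u v : V).

Lemma submodD W u v : is_submod W -> W u -> W v -> W (u + v).
Proof. by move=> [_ WZ] Wu Wv; rewrite -[u]scale1r; apply: WZ. Qed.

Lemma submodZ W a u : is_submod W -> W u -> W (a *: u).
Proof. by move=> [W0 WZ] Wu; rewrite -[_ *: _]addr0; apply: WZ. Qed.

Lemma submodN W u : is_submod W -> W u -> W (- u).
Proof. by move=> WP Wu; rewrite -scaleN1r; apply: submodZ. Qed.

Lemma submodB W u v : is_submod W -> W u -> W v -> W (u - v).
Proof. by move=> WP Wu Wv; apply: submodD => //; apply: submodN. Qed.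

Lemma submod_sum W (I : Type) (r : seq I) (P : pred I) (F : I -> V) :
  is_submod W -> (forall i, P i -> W (F i)) -> W (\sum_(i <- r | P i) F i).
Proof.
move=> WP WF; apply: big_ind => //; first by case: WP.
by move=> x y; apply: submodD.
Qed.

Lemma lspan_submod S : is_submod (lspan S).
Proof.
split=> [W [] //|a u v Su Sv W WP SW].
by case: (WP) => _; apply; [apply: Su|apply: Sv].
Qed.

Lemma sub_lspan S : S `<=` lspan S.
Proof. by move=> x Sx W _; apply. Qed.

Lemma lspan_min S W : is_submod W -> S `<=` W -> lspan S `<=` W.
Proof. by move=> WP SW x; apply. Qed.

Definition lquot_rel S : rel V := fun u v => `[< lspan S (u - v) >].

Fact lquot_refl S : reflexive (lquot_rel S).
Proof. by move=> u; apply/asboolP; rewrite subrr; case: (lspan_submod S). Qed.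

Fact lquot_sym S : symmetric (lquot_rel S).
Proof.
move=> u v; apply/asboolP/asboolP => h; rewrite -opprB;
  exact: submodN (lspan_submod S) h.
Qed.

Fact lquot_trans S : transitive (lquot_rel S).
Proof.
move=> v u w /asboolP uv /asboolP vw; apply/asboolP.
by rewrite -(subrK v u) -addrA; apply: submodD (lspan_submod S) uv vw.
Qed.

Canonical lquot_equiv S :=
  EquivRel (lquot_rel S) (@lquot_refl S) (@lquot_sym S) (@lquot_trans S).

Definition lquot S := {eq_quot (lquot_equiv S)}.
HB.instance Definition _ S := Choice.on (lquot S).

Definition lclass S (v : V) : lquot S := \pi_({eq_quot (lquot_equiv S)}) v.
Definition lrepr S (x : lquot S) : V := repr x.

Lemma lreprK S (x : lquot S) : lclass S (lrepr x) = x.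
Proof. exact: reprK. Qed.

Lemma lclassP S u v : lclass S u = lclass S v <-> lspan S (u - v).
Proof.
by split=> [/eqmodP/asboolP|h]; last by apply/eqmodP/asboolP.
Qed.

Lemma lreprP S v : lspan S (lrepr (lclass S v) - v).
Proof. by apply/lclassP; rewrite lreprK. Qed.

Definition lquot_add S (x y : lquot S) := lclass S (lrepr x + lrepr y).
Definition lquot_opp S (x : lquot S) := lclass S (- lrepr x).
Definition lquot_scale S (a : rat) (x : lquot S) := lclass S (a *: lrepr x).

Fact lclassD_subproof S u v :
  lquot_add (lclass S u) (lclass S v) = lclass S (u + v).
Proof.
apply/lclassP; rewrite opprD addrACA.
by apply: submodD (lspan_submod S) _ _; apply: lreprP.
Qed.

Fact lclassN_subproof S u : lquot_opp (lclass S u) = lclass S (- u).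
Proof.
by apply/lclassP; rewrite -opprD; apply: submodN (lspan_submod S) _;
  apply: lreprP.
Qed.

Fact lclassZ_subproof S a u : lquot_scale a (lclass S u) = lclass S (a *: u).
Proof.
by apply/lclassP; rewrite -scalerBr; apply: submodZ (lspan_submod S) _;
  apply: lreprP.
Qed.

Fact lquot_addA S : associative (@lquot_add S).
Proof.
move=> x y z; rewrite -(lreprK x) -(lreprK y) -(lreprK z).
by rewrite !lclassD_subproof addrA.
Qed.
Fact lquot_addC S : commutative (@lquot_add S).
Proof. by move=> x y; rewrite /lquot_add addrC. Qed.
Fact lquot_add0 S : left_id (lclass S 0) (@lquot_add S).
Proof. by move=> x; rewrite -(lreprK x) lclassD_subproof add0r. Qed.
Fact lquot_addN S : left_inverse (lclass S 0) (@lquot_opp S) (@lquot_add S).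
Proof.
by move=> x; rewrite -(lreprK x) lclassN_subproof lclassD_subproof addNr.
Qed.

HB.instance Definition _ S := GRing.isZmodule.Build (lquot S)
  (@lquot_addA S) (@lquot_addC S) (@lquot_add0 S) (@lquot_addN S).

Lemma lclassD S u v : lclass S (u + v) = lclass S u + lclass S v.
Proof. by rewrite -lclassD_subproof. Qed.

Fact lquot_scaleA S a b (x : lquot S) :
  lquot_scale a (lquot_scale b x) = lquot_scale (a * b) x.
Proof. by rewrite -(lreprK x) !lclassZ_subproof scalerA. Qed.
Fact lquot_scale1 S : left_id 1 (@lquot_scale S).
Proof. by move=> x; rewrite -(lreprK x) lclassZ_subproof scale1r. Qed.
Fact lquot_scaleDr S : right_distributive (@lquot_scale S) +%R.
Proof.
move=> a x y; rewrite -(lreprK x) -(lreprK y) -lclassD !lclassZ_subproof.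
by rewrite -lclassD scalerDr.
Qed.
Fact lquot_scaleDl S (x : lquot S) :
  {morph (@lquot_scale S)^~ x : a b / a + b}.
Proof.
by move=> a b; rewrite -(lreprK x) !lclassZ_subproof -lclassD scalerDl.
Qed.

HB.instance Definition _ S := GRing.Zmodule_isLmodule.Build rat (lquot S)
  (@lquot_scaleA S) (@lquot_scale1 S) (@lquot_scaleDr S) (@lquot_scaleDl S).

Fact lclass_linear S : linear (lclass S).
Proof. by move=> a u v; rewrite lclassD -lclassZ_subproof. Qed.

HB.instance Definition _ S :=
  GRing.isLinear.Build rat V (lquot S) _ (lclass S) (lclass_linear S).

Lemma lclass0 S v : lspan S v -> lclass S v = 0.
Proof.
by move=> Sv; rewrite -(raddf0 (lclass S)); apply/lclassP; rewrite subr0.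
Qed.

End Submodules.

Section Kernel.
Variables (U V : lmodType rat) (f : {linear U -> V}).

Definition kerp : {pred U} := [pred x | f x == 0].

Fact kerp_submod : GRing.subsemimod_closed kerp.
Proof.
split; first split.
- by rewrite inE raddf0.
- by move=> x y; rewrite !inE linearD => /eqP-> /eqP->; rewrite addr0.
- by move=> a x; rewrite !inE linearZ /= => /eqP->; rewrite scaler0.
Qed.

HB.instance Definition _ := GRing.isSubmodClosed.Build rat U kerp kerp_submod.

Record ker : Type := Ker { ker_val : U; _ : ker_val \in kerp }.

HB.instance Definition _ := [isSub for ker_val].
HB.instance Definition _ := [Choice of ker by <:].
HB.instance Definition _ := [SubChoice_isSubLmodule of ker by <:].

End Kernel.

Definition homology (A B C : lmodType rat) (d : {linear A -> B})
    (e : {linear B -> C}) : lmodType rat :=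
  lquot [set z : ker e | exists a : A, ker_val z = d a].

(** [{malg rat[K]}] is the vector space with basis [<< k >>], [k : K]; [lext f]
    is the linear map which sends [<< k >>] to [f k]. *)

Definition lext (K : choiceType) (V : lmodType rat) (f : K -> V)
    (c : {malg rat[K]}) : V := \sum_(k <- msupp c) c@_k *: f k.

Section LinearExtension.
Variables (K : choiceType) (V : lmodType rat) (f : K -> V).

Lemma lextEw (c : {malg rat[K]}) (d : {fset K}) :
  (msupp c `<=` d)%fset -> lext f c = \sum_(k <- d) c@_k *: f k.
Proof.
move=> le_cd; rewrite /lext; apply: big_fset_incl => // k _ /mcoeff_outdom->.
by rewrite scale0r.
Qed.

Fact lext_linear : linear (lext f).
Proof.
move=> a c1 c2; pose d := (msupp c1 `|` msupp c2)%fset.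
have le1 : (msupp c1 `<=` d)%fset by apply: fsubsetUl.
have le2 : (msupp c2 `<=` d)%fset by apply: fsubsetUr.
have le3 : (msupp (a *: c1 + c2) `<=` d)%fset.
  apply: (fsubset_trans (msuppD_le _ _)); apply: fsetSU; exact: msuppZ_le.
rewrite (lextEw le1) (lextEw le2) (lextEw le3) scaler_sumr -big_split /=.
by apply: eq_bigr => k _; rewrite mcoeffD mcoeffZ scalerDl scalerA.
Qed.

HB.instance Definition _ :=
  GRing.isLinear.Build rat {malg rat[K]} V _ (lext f) lext_linear.

Lemma lextU k : lext f << k >> = f k.
Proof.
rewrite (lextEw (d := [fset k]%fset)) ?big_seq_fset1 ?mcoeffUU ?scale1r //.
exact: msuppU_le.
Qed.

End LinearExtension.

Definition is_alternating (V W : lmodType rat) (B : V -> V -> W) : Prop :=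
  [/\ forall w, linear (B^~ w), forall v, linear (B v)
    & forall v, B v v = 0].

Inductive ext2_rels (V : lmodType rat) : set {malg rat[(V * V)%type]} :=
| Ext2Linl (a : rat) (u v w : V) :
    ext2_rels (<< (a *: u + v, w) >> - a *: << (u, w) >> - << (v, w) >>)
| Ext2Linr (a : rat) (u v w : V) :
    ext2_rels (<< (w, a *: u + v) >> - a *: << (w, u) >> - << (w, v) >>)
| Ext2Alt (v : V) : ext2_rels << (v, v) >>.

Definition ext2 (V : lmodType rat) : lmodType rat := lquot (@ext2_rels V).

Definition wedge (V : lmodType rat) (u v : V) : ext2 V :=
  lclass (@ext2_rels V) << (u, v) >>.

(** Meaningful only for alternating bilinear [B], see [ext2_lift_linear] and
    [ext2_lift_wedge]. *)

Definition ext2_lift (V W : lmodType rat) (B : V -> V -> W) (x : ext2 V) : W :=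
  lext (fun p => B p.1 p.2) (lrepr x).

Section ExteriorSquare.
Variables (V W : lmodType rat) (B : V -> V -> W).
Hypothesis altB : is_alternating B.

Let F := fun p : V * V => B p.1 p.2.

Lemma ext2_lift_class c : ext2_lift B (lclass (@ext2_rels V) c) = lext F c.
Proof.
apply/eqP; rewrite -subr_eq0 /ext2_lift -linearB /=; apply/eqP.
move: (_ - _) (@lreprP _ (@ext2_rels V) c); apply: lspan_min.
  split=> [|a u v /= hu hv]; first by rewrite raddf0.
  by rewrite linearP /= hu hv scaler0 addr0.
have [Bl Br Bv] := altB.
move=> _ [a u v w|a u v w|v] ; rewrite ?linearB /= ?linearZ /= ?lextU /F /= ?Bv //.
  by have /= -> := Bl w a u v; rewrite scalerN addrAC addrK subrr.
by have /= -> := Br w a u v; rewrite scalerN addrAC addrK subrr.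
Qed.

Lemma ext2_lift_linear : linear (ext2_lift B).
Proof.
move=> a x y. rewrite -[x in LHS]lreprK -[y in LHS]lreprK.
have -> : a *: lclass _ (lrepr x) + lclass _ (lrepr y) = lclass (@ext2_rels V) (a *: lrepr x + lrepr y) by rewrite linearP.
by rewrite ext2_lift_class linearP.
Qed.
Lemma ext2_lift_wedge u v : ext2_lift B (wedge u v) = B u v.
Proof. by rewrite ext2_lift_class lextU. Qed.
End ExteriorSquare.

Lemma wedge_alternating (V : lmodType rat) : is_alternating (@wedge V).
Proof.
have E (a : rat) (x y : {malg rat[(V * V)%type]}) :
    a *: (lclass _ x : ext2 V) + lclass _ y = lclass (@ext2_rels V) (a *: x + y).
  by rewrite [RHS]linearP.
split=> [w a u v|w a u v|v]; rewrite /wedge.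
- rewrite E; apply/lclassP; apply: sub_lspan.
  by rewrite opprD addrA; exact: Ext2Linl.
- rewrite E; apply/lclassP; apply: sub_lspan.
  by rewrite opprD addrA; exact: Ext2Linr.
- by apply: lclass0; apply: sub_lspan; exact: Ext2Alt.
Qed.

HB.mixin Record isLieAlgebra L of GRing.Lmodule rat L := {
  lbr : L -> L -> L;
  lbr_linearl : forall w : L, linear (lbr^~ w);
  lbr_linearr : forall w : L, linear (lbr w);
  lbrxx : forall u : L, lbr u u = 0;
  lbr_jacobi : forall u v w : L,
    lbr u (lbr v w) + lbr v (lbr w u) + lbr w (lbr u v) = 0
}.

#[short(type="lieType")]
HB.structure Definition LieAlgebra := { L of isLieAlgebra L & GRing.Lmodule rat L }.

Section LieTheory.
Variable L : lieType.
Implicit Types u v w : L.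

Lemma lbrDl u v w : lbr (u + v) w = lbr u w + lbr v w.
Proof. by have /= := lbr_linearl w 1 u v; rewrite !scale1r. Qed.
Lemma lbrDr u v w : lbr w (u + v) = lbr w u + lbr w v.
Proof. by have /= := lbr_linearr w 1 u v; rewrite !scale1r. Qed.
Lemma lbr0l w : lbr 0 w = 0.
Proof. by apply: (addIr (lbr 0 w)); rewrite -lbrDl !add0r. Qed.
Lemma lbr0r w : lbr w 0 = 0.
Proof. by apply: (addIr (lbr w 0)); rewrite -lbrDr !add0r. Qed.
Lemma lbrZl a u w : lbr (a *: u) w = a *: lbr u w.
Proof. by have /= := lbr_linearl w a u 0; rewrite lbr0l !addr0. Qed.
Lemma lbrZr a u w : lbr w (a *: u) = a *: lbr w u.
Proof. by have /= := lbr_linearr w a u 0; rewrite lbr0r !addr0. Qed.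
Lemma lbrNl u w : lbr (- u) w = - lbr u w.
Proof. by rewrite -scaleN1r lbrZl scaleN1r. Qed.
Lemma lbrNr u w : lbr w (- u) = - lbr w u.
Proof. by rewrite -scaleN1r lbrZr scaleN1r. Qed.
Lemma lbrC u v : lbr u v = - lbr v u.
Proof.
apply/eqP; rewrite -addr_eq0; apply/eqP.
by have := lbrxx (u + v); rewrite lbrDl !lbrDr !lbrxx add0r addr0.
Qed.

End LieTheory.

Record is_grading (L : lieType) (gr : nat -> set L) : Prop := IsGrading {
  grading_submod : forall n, is_submod (gr n);
  grading_lbr : forall i j u v, gr i u -> gr j v -> gr (i + j)%N (lbr u v);
  grading_sum : forall x, exists (n : nat) (u : nat -> L),
    (forall i, gr i (u i)) /\ x = \sum_(0 <= i < n) u i;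
  grading_direct : forall (n : nat) (u : nat -> L), (forall i, gr i (u i)) ->
    \sum_(0 <= i < n) u i = 0 -> forall i, (i < n)%N -> u i = 0
}.

Record grading (L : lieType) := Grading {
  gr :> nat -> set L;
  gradingP : is_grading gr
}.

Definition graded_lie_isomorphic (L L' : lieType) (gL : grading L)
    (gL' : grading L') : Prop :=
  exists phi : {linear L -> L'},
    [/\ bijective phi,
        forall u v, phi (lbr u v) = lbr (phi u) (phi v)
      & forall n, phi @` gL n = gL' n].

Definition is_ideal (L : lieType) (I : set L) : Prop :=
  is_submod I /\ forall u v, I u -> I (lbr u v).

Definition ideal_gen (L : lieType) (S : set L) : set L :=
  [set x | forall I : set L, is_ideal I -> S `<=` I -> I x].

Section LieQuotient.
Variables (L : lieType) (S : set L).

Lemma ideal_gen_ideal : is_ideal (ideal_gen S).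
Proof.
split; first split.
- by move=> I [[]].
- move=> a u v Iu Iv I II SI.
  by case: (II) => -[_ +] _; apply; [apply: Iu|apply: Iv].
- move=> u v Iu I II SI; case: (II) => _; apply; exact: Iu.
Qed.

Lemma sub_ideal_gen : S `<=` ideal_gen S.
Proof. by move=> x Sx I _; apply. Qed.

Lemma lspan_ideal_gen x : lspan (ideal_gen S) x -> ideal_gen S x.
Proof. by apply: lspan_min => //; case: ideal_gen_ideal. Qed.

Local Notation lie_quot := (lquot (ideal_gen S)).
Local Notation lie_class := (lclass (ideal_gen S)).

Lemma lie_classP u v : lie_class u = lie_class v <-> ideal_gen S (u - v).
Proof.
split=> [/lclassP/lspan_ideal_gen//|h].
by apply/lclassP; apply: sub_lspan.
Qed.

Lemma lie_class_surj (x : lie_quot) : exists u, x = lie_class u.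
Proof. by exists (lrepr x); rewrite lreprK. Qed.

Definition lie_quot_br (x y : lie_quot) : lie_quot :=
  lie_class (lbr (lrepr x) (lrepr y)).

Fact lie_quot_brE u v :
  lie_quot_br (lie_class u) (lie_class v) = lie_class (lbr u v).
Proof.
have [Isub Ibr] := ideal_gen_ideal.
have hu := lspan_ideal_gen (@lreprP _ (ideal_gen S) u).
have hv := lspan_ideal_gen (@lreprP _ (ideal_gen S) v).
apply/lie_classP.
rewrite -[X in lbr X _](subrK u) lbrDl -addrA; apply: (submodD Isub).
  exact: Ibr.
by rewrite -lbrNr -lbrDr lbrC; apply: (submodN Isub); exact: Ibr.
Qed.

Fact lie_quot_linearl (w : lie_quot) : linear (lie_quot_br^~ w).
Proof.
move=> a u v; have [u' ->] := lie_class_surj u.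
have [v' ->] := lie_class_surj v; have [w' ->] := lie_class_surj w.
by rewrite -linearP !lie_quot_brE -linearP lbrDl lbrZl.
Qed.

Fact lie_quot_linearr (w : lie_quot) : linear (lie_quot_br w).
Proof.
move=> a u v; have [u' ->] := lie_class_surj u.
have [v' ->] := lie_class_surj v; have [w' ->] := lie_class_surj w.
by rewrite -linearP !lie_quot_brE -linearP lbrDr lbrZr.
Qed.

Fact lie_quot_brxx (u : lie_quot) : lie_quot_br u u = 0.
Proof.
by have [u' ->] := lie_class_surj u; rewrite lie_quot_brE lbrxx linear0.
Qed.

Fact lie_quot_jacobi (u v w : lie_quot) :
  lie_quot_br u (lie_quot_br v w) + lie_quot_br v (lie_quot_br w u)
  + lie_quot_br w (lie_quot_br u v) = 0.
Proof.
have [u' ->] := lie_class_surj u; have [v' ->] := lie_class_surj v.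
have [w' ->] := lie_class_surj w.
by rewrite !lie_quot_brE -!lclassD lbr_jacobi linear0.
Qed.

HB.instance Definition _ := isLieAlgebra.Build (lie_quot)
  lie_quot_linearl lie_quot_linearr lie_quot_brxx lie_quot_jacobi.

End LieQuotient.

Definition lie_quot (L : lieType) (S : set L) : lieType := lquot (ideal_gen S).

Definition lie_class (L : lieType) (S : set L) : {linear L -> lie_quot S} :=
  lclass (ideal_gen S).

Lemma lie_class_br (L : lieType) (S : set L) (u v : L) :
  lie_class S (lbr u v) = lbr (lie_class S u) (lie_class S v).
Proof. exact: esym (lie_quot_brE _ _ _). Qed.

(** A set is homogeneous when the ideal [I] it generates contains the
    homogeneous components of its elements; the quotient by [I] is then graded
    by the images of the graded pieces. *)

Definition homogeneous_in (L : lieType) (gL : grading L) (I : set L) : set L :=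
  [set u | I u /\ exists n, gL n u].

Definition is_homogeneous (L : lieType) (gL : grading L) (S : set L) : Prop :=
  S `<=` lspan (homogeneous_in gL (ideal_gen S)).

Fact sum_trunc (V : lmodType rat) (k l : nat) (z : nat -> V) : (k <= l)%N ->
  \sum_(0 <= i < k) z i = \sum_(0 <= i < l) (if (i < k)%N then z i else 0).
Proof.
move=> le_kl; rewrite [RHS](big_cat_nat (n := k)) //=.
rewrite [X in _ = _ + X]big1_seq ?addr0.
  by apply: eq_big_nat => i /andP[_ ->].
move=> i; rewrite mem_index_iota => /= /andP[le_ki _].
by rewrite ltnNge le_ki.
Qed.

Fact lspan_components (V : lmodType rat) (W : nat -> set V) (x : V) :
  (forall n, is_submod (W n)) -> lspan [set y | exists n, W n y] x ->
  exists (n : nat) (w : nat -> V),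
    (forall i, W i (w i)) /\ x = \sum_(0 <= i < n) w i.
Proof.
move=> Wsub; move: x; apply: lspan_min; first split=> /=.
- exists 0%N, (fun=> 0); rewrite big_geq //; split=> // i.
  by case: (Wsub i).
- move=> a _ _ [n [w [wP ->]]] [m [t [tP ->]]].
  have truncP k z i : W i (z i) -> W i (if (i < k)%N then z i else 0).
    by case: ifP => // _ _; case: (Wsub i).
  exists (maxn n m), (fun i => a *: (if (i < n)%N then w i else 0)
                               + (if (i < m)%N then t i else 0)); split.
    by move=> i; case: (Wsub i) => _; apply; apply: truncP.
  rewrite (@sum_trunc _ n (maxn n m)) ?leq_maxl //.
  rewrite (@sum_trunc _ m (maxn n m)) ?leq_maxr //.
  by rewrite big_split /= scaler_sumr.
- move=> u [k gu]; exists k.+1, (fun i => if i == k then u else 0); split.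
    by move=> i; case: eqP => [->//|_]; case: (Wsub i).
  rewrite big_nat_recr //= eqxx big1_seq ?add0r // => i /=.
  by rewrite mem_index_iota => /andP[_ /ltn_eqF->].
Qed.

Section QuotientGrading.
Variables (L : lieType) (gL : grading L) (S : set L).
Hypothesis homS : is_homogeneous gL S.

Let J := lspan (homogeneous_in gL (ideal_gen S)).

Fact homogeneous_ideal : is_ideal J.
Proof.
split; first exact: lspan_submod.
move=> u v Ju; have [n [w [gw ->]]] := grading_sum (gradingP gL) v.
move: u Ju; apply: lspan_min.
  split=> [|a u1 u2 h1 h2]; first by rewrite /= lbr0l; case: (lspan_submod (homogeneous_in gL (ideal_gen S))).
  rewrite /= lbrDl lbrZl.
  by case: (lspan_submod (homogeneous_in gL (ideal_gen S))) => _; apply.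
move=> u [Iu [m gu]] /=.
have -> : lbr u (\sum_(0 <= i < n) w i) = \sum_(0 <= i < n) lbr u (w i).
  apply: (big_morph (lbr u) (id1 := 0)); last exact: lbr0r.
  by move=> x y; rewrite lbrDr.
apply: submod_sum; first exact: lspan_submod.
move=> i _; apply: sub_lspan; split.
  by case: (ideal_gen_ideal S) => _; apply.
by exists (m + i)%N; apply: grading_lbr (gradingP gL) _ _ _ _ gu (gw i).
Qed.

Fact homogeneous_components u : ideal_gen S u ->
  exists (n : nat) (w : nat -> L),
    (forall i, gL i (w i) /\ ideal_gen S (w i)) /\ u = \sum_(0 <= i < n) w i.
Proof.
move=> Iu; have [Isub _] := ideal_gen_ideal S.
apply: (@lspan_components _ (fun i => [set x | gL i x /\ ideal_gen S x])).
  move=> i; have gsub := grading_submod (gradingP gL) i.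
  split; first by split; [case: gsub|case: Isub].
  move=> a x y [gx Ix] [gy Iy].
  by split; [case: gsub => _|case: Isub => _]; apply.
have Ju : J u by apply: Iu; [exact: homogeneous_ideal | exact: homS].
by move=> W WP sW; apply: Ju => // x [Ix [n gx]]; apply: sW; exists n.
Qed.

Fact lie_quot_is_grading : is_grading (fun n => lie_class S @` gL n).
Proof.
have gsub i := grading_submod (gradingP gL) i.
have [Isub _] := ideal_gen_ideal S.
split.
- move=> n; split.
    by exists 0; [case: (gsub n)|rewrite linear0].
  move=> a _ _ [u gu <-] [v gv <-]; exists (a *: u + v); last by rewrite linearP.
  by case: (gsub n) => _; apply.
- move=> i j _ _ [u gu <-] [v gv <-]; exists (lbr u v); last exact: lie_class_br.
  exact: grading_lbr (gradingP gL) _ _ _ _ gu gv.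
- move=> x; have [u ->] := lie_class_surj x.
  have [n [w [gw ->]]] := grading_sum (gradingP gL) u.
  exists n, (fun i => lie_class S (w i)); split; first by move=> i; exists (w i).
  exact: (raddf_sum (lie_class S)).
- move=> n u gu su0.
  have [w gw wE] : exists2 w : nat -> L, forall i, gL i (w i)
      & forall i, lie_class S (w i) = u i.
    have h i : exists w, gL i w /\ lie_class S w = u i.
      by have [w ? ?] := gu i; exists w.
    by exists (fun i => projT1 (cid (h i))) => i; case: cid => w [].
  have Iw : ideal_gen S (\sum_(0 <= i < n) w i).
    have e0 : lie_class S (\sum_(0 <= i < n) w i) = lie_class S 0.
      rewrite [RHS]raddf0 raddf_sum -[RHS]su0.
      by apply: eq_bigr => i _; exact: wE.
    by move/lie_classP: e0; rewrite subr0.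
  have [m [t [tP wt]]] := homogeneous_components Iw.
  pose d i := (if (i < n)%N then w i else 0) - (if (i < m)%N then t i else 0).
  have dg i : gL i (d i).
    apply: submodB => //; case: ifP => _ //; try by case: (gsub i).
    by case: (tP i).
  move=> i lt_in; rewrite -wE.
  have /grading_direct : \sum_(0 <= j < maxn n m) d j = 0.
    rewrite /d big_split /= sumrN -!sum_trunc ?leq_maxl ?leq_maxr //.
    by rewrite wt subrr.
  move=> /(_ _ (gradingP gL) dg i); rewrite leq_max lt_in => /(_ isT).
  rewrite /d lt_in => /eqP; rewrite subr_eq0 => /eqP ->.
  suff /lie_classP : ideal_gen S ((if (i < m)%N then t i else 0) - 0).
    by move=> e; apply: etrans e _; exact: raddf0.
  by rewrite subr0; case: ifP => _; [case: (tP i)|case: Isub].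
Qed.

Definition lie_quot_grading : grading (lie_quot S) :=
  Grading lie_quot_is_grading.

End QuotientGrading.

(** The free Lie algebra on a vector space [V]: formal Lie expressions in the
    elements of [V], modulo the laws of Lie algebras and the linearity of the
    inclusion of [V]. *)

Inductive lie_term (V : Type) : Type :=
| LieGen of V
| LieZero
| LieAdd of lie_term V & lie_term V
| LieOpp of lie_term V
| LieScale of rat & lie_term V
| LieBr of lie_term V & lie_term V.
Arguments LieZero {V}.

HB.instance Definition _ (V : Type) := gen_eqMixin (lie_term V).
HB.instance Definition _ (V : Type) := gen_choiceMixin (lie_term V).

Inductive lie_eq (V : lmodType rat) : lie_term V -> lie_term V -> Prop :=
| LieRefl t : lie_eq t t
| LieSym s t : lie_eq s t -> lie_eq t s
| LieTrans s t r : lie_eq s t -> lie_eq t r -> lie_eq s r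
| LieCongAdd s s' t t' :
    lie_eq s s' -> lie_eq t t' -> lie_eq (LieAdd s t) (LieAdd s' t')
| LieCongOpp s s' : lie_eq s s' -> lie_eq (LieOpp s) (LieOpp s')
| LieCongScale a s s' : lie_eq s s' -> lie_eq (LieScale a s) (LieScale a s')
| LieCongBr s s' t t' :
    lie_eq s s' -> lie_eq t t' -> lie_eq (LieBr s t) (LieBr s' t')
| LieAddA r s t : lie_eq (LieAdd r (LieAdd s t)) (LieAdd (LieAdd r s) t)
| LieAddC s t : lie_eq (LieAdd s t) (LieAdd t s)
| LieAdd0 t : lie_eq (LieAdd LieZero t) t
| LieAddN t : lie_eq (LieAdd (LieOpp t) t) LieZero
| LieScaleA a b t : lie_eq (LieScale a (LieScale b t)) (LieScale (a * b) t)
| LieScale1 t : lie_eq (LieScale 1 t) t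
| LieScaleDr a s t :
    lie_eq (LieScale a (LieAdd s t)) (LieAdd (LieScale a s) (LieScale a t))
| LieScaleDl a b t :
    lie_eq (LieScale (a + b) t) (LieAdd (LieScale a t) (LieScale b t))
| LieBrLinl a r s t : lie_eq (LieBr (LieAdd (LieScale a r) s) t)
    (LieAdd (LieScale a (LieBr r t)) (LieBr s t))
| LieBrLinr a r s t : lie_eq (LieBr t (LieAdd (LieScale a r) s))
    (LieAdd (LieScale a (LieBr t r)) (LieBr t s))
| LieBrAlt t : lie_eq (LieBr t t) LieZero
| LieJacobi r s t : lie_eq (LieAdd (LieAdd (LieBr r (LieBr s t))
    (LieBr s (LieBr t r))) (LieBr t (LieBr r s))) LieZero
| LieGenLin a (u v : V) : lie_eq (LieGen (a *: u + v))
    (LieAdd (LieScale a (LieGen u)) (LieGen v)).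

Section FreeLie.
Variable V : lmodType rat.

Definition lie_rel : rel (lie_term V) := fun s t => `[< lie_eq s t >].

Fact lie_rel_refl : reflexive lie_rel.
Proof. by move=> t; apply/asboolP; exact: LieRefl. Qed.
Fact lie_rel_sym : symmetric lie_rel.
Proof. by move=> s t; apply/asboolP/asboolP => h; exact: LieSym. Qed.
Fact lie_rel_trans : transitive lie_rel.
Proof.
by move=> s r t /asboolP rs /asboolP st; apply/asboolP; exact: LieTrans st.
Qed.

Canonical lie_equiv := EquivRel lie_rel lie_rel_refl lie_rel_sym lie_rel_trans.

Definition lie := {eq_quot lie_equiv}.
HB.instance Definition _ := Choice.on lie.

Definition free_lie_class (t : lie_term V) : lie := \pi_{eq_quot lie_equiv} t.
Local Notation cl := free_lie_class.

Lemma free_lie_classP s t : cl s = cl t <-> lie_eq s t.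
Proof. by split=> [/eqmodP/asboolP|h]; last by apply/eqmodP/asboolP. Qed.

Lemma free_lie_classK (x : lie) : cl (repr x) = x.
Proof. exact: reprK. Qed.

Lemma free_lie_surj (x : lie) : exists t, x = cl t.
Proof. by exists (repr x); rewrite free_lie_classK. Qed.

Lemma free_lie_reprP t : lie_eq (repr (cl t)) t.
Proof. by apply/free_lie_classP; rewrite free_lie_classK. Qed.

Definition free_lie_add (x y : lie) := cl (LieAdd (repr x) (repr y)).
Definition free_lie_opp (x : lie) := cl (LieOpp (repr x)).
Definition free_lie_scale a (x : lie) := cl (LieScale a (repr x)).
Definition free_lie_br (x y : lie) := cl (LieBr (repr x) (repr y)).

Fact free_lie_addE s t : free_lie_add (cl s) (cl t) = cl (LieAdd s t).
Proof. by apply/free_lie_classP; apply: LieCongAdd; exact: free_lie_reprP. Qed.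
Fact free_lie_oppE t : free_lie_opp (cl t) = cl (LieOpp t).
Proof. by apply/free_lie_classP; apply: LieCongOpp; exact: free_lie_reprP. Qed.
Fact free_lie_scaleE a t : free_lie_scale a (cl t) = cl (LieScale a t).
Proof. by apply/free_lie_classP; apply: LieCongScale; exact: free_lie_reprP. Qed.
Fact free_lie_brE s t : free_lie_br (cl s) (cl t) = cl (LieBr s t).
Proof. by apply/free_lie_classP; apply: LieCongBr; exact: free_lie_reprP. Qed.

Let E := (free_lie_addE, free_lie_oppE, free_lie_scaleE, free_lie_brE).

Fact free_lie_addA : associative free_lie_add.
Proof.
move=> x y z; have [r ->] := free_lie_surj x; have [s ->] := free_lie_surj y.
have [t ->] := free_lie_surj z; rewrite !E; apply/free_lie_classP; exact: LieAddA.
Qed.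
Fact free_lie_addC : commutative free_lie_add.
Proof. by move=> x y; apply/free_lie_classP; exact: LieAddC. Qed.
Fact free_lie_add0 : left_id (cl LieZero) free_lie_add.
Proof.
move=> x; have [r ->] := free_lie_surj x; rewrite !E.
by apply/free_lie_classP; exact: LieAdd0.
Qed.
Fact free_lie_addN : left_inverse (cl LieZero) free_lie_opp free_lie_add.
Proof.
move=> x; have [r ->] := free_lie_surj x; rewrite !E.
by apply/free_lie_classP; exact: LieAddN.
Qed.

HB.instance Definition _ := GRing.isZmodule.Build lie
  free_lie_addA free_lie_addC free_lie_add0 free_lie_addN.

Fact free_lie_scaleA a b x :
  free_lie_scale a (free_lie_scale b x) = free_lie_scale (a * b) x.
Proof.
have [r ->] := free_lie_surj x; rewrite !E.
by apply/free_lie_classP; exact: LieScaleA.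
Qed.
Fact free_lie_scale1 : left_id 1 free_lie_scale.
Proof.
move=> x; have [r ->] := free_lie_surj x; rewrite !E.
by apply/free_lie_classP; exact: LieScale1.
Qed.

Lemma free_lie_classD s t : cl (LieAdd s t) = cl s + cl t.
Proof. exact: esym (free_lie_addE s t). Qed.

Fact free_lie_scaleDr : right_distributive free_lie_scale +%R.
Proof.
move=> a x y; have [r ->] := free_lie_surj x; have [s ->] := free_lie_surj y.
rewrite -free_lie_classD !E -free_lie_classD.
by apply/free_lie_classP; exact: LieScaleDr.
Qed.
Fact free_lie_scaleDl x : {morph free_lie_scale^~ x : a b / a + b}.
Proof.
move=> a b /=; have [r ->] := free_lie_surj x.
rewrite !E -free_lie_classD.
by apply/free_lie_classP; exact: LieScaleDl.
Qed.

HB.instance Definition _ := GRing.Zmodule_isLmodule.Build rat lie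
  free_lie_scaleA free_lie_scale1 free_lie_scaleDr free_lie_scaleDl.

Lemma free_lie_classZ a t : cl (LieScale a t) = a *: cl t.
Proof. exact: esym (free_lie_scaleE a t). Qed.

Lemma free_lie_class0 : cl LieZero = 0.
Proof. by []. Qed.

Fact free_lie_linearl (w : lie) : linear (free_lie_br^~ w).
Proof.
move=> a x y; have [r ->] := free_lie_surj x; have [s ->] := free_lie_surj y.
have [t ->] := free_lie_surj w.
rewrite -free_lie_classZ -free_lie_classD !E -free_lie_classZ -free_lie_classD.
by apply/free_lie_classP; exact: LieBrLinl.
Qed.
Fact free_lie_linearr (w : lie) : linear (free_lie_br w).
Proof.
move=> a x y; have [r ->] := free_lie_surj x; have [s ->] := free_lie_surj y.
have [t ->] := free_lie_surj w.
rewrite -free_lie_classZ -free_lie_classD !E -free_lie_classZ -free_lie_classD.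
by apply/free_lie_classP; exact: LieBrLinr.
Qed.
Fact free_lie_brxx (x : lie) : free_lie_br x x = 0.
Proof.
have [r ->] := free_lie_surj x; rewrite !E -free_lie_class0.
by apply/free_lie_classP; exact: LieBrAlt.
Qed.
Fact free_lie_jacobi (x y z : lie) :
  free_lie_br x (free_lie_br y z) + free_lie_br y (free_lie_br z x)
  + free_lie_br z (free_lie_br x y) = 0.
Proof.
have [r ->] := free_lie_surj x; have [s ->] := free_lie_surj y.
have [t ->] := free_lie_surj z; rewrite !E -!free_lie_classD -free_lie_class0.
by apply/free_lie_classP; exact: LieJacobi.
Qed.

HB.instance Definition _ := isLieAlgebra.Build lie
  free_lie_linearl free_lie_linearr free_lie_brxx free_lie_jacobi.

Lemma free_lie_class_br s t : cl (LieBr s t) = lbr (cl s) (cl t).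
Proof. exact: esym (free_lie_brE s t). Qed.

Definition lie_gen_fun (v : V) : lie := cl (LieGen v).

Fact lie_gen_linear : linear lie_gen_fun.
Proof.
move=> a u v; rewrite /lie_gen_fun -free_lie_classZ -free_lie_classD.
by apply/free_lie_classP; exact: LieGenLin.
Qed.

HB.instance Definition _ :=
  GRing.isLinear.Build rat V lie _ lie_gen_fun lie_gen_linear.

End FreeLie.

Definition lie_gen (V : lmodType rat) : {linear V -> lie V} := @lie_gen_fun V.

Section FreeLieLift.
Variables (V : lmodType rat) (L : lieType) (f : {linear V -> L}).

Fixpoint lie_eval (t : lie_term V) : L :=
  match t with
  | LieGen v => f v
  | LieZero => 0
  | LieAdd s t => lie_eval s + lie_eval t
  | LieOpp t => - lie_eval t
  | LieScale a t => a *: lie_eval t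
  | LieBr s t => lbr (lie_eval s) (lie_eval t)
  end.

Fact lie_eval_eq s t : lie_eq s t -> lie_eval s = lie_eval t.
Proof.
elim=> //=.
- by move=> ? ? ? _ -> _ ->.
- by move=> ? ? ? ? _ -> _ ->.
- by move=> ? ? _ ->.
- by move=> ? ? ? _ ->.
- by move=> ? ? ? ? _ -> _ ->.
- by move=> *; rewrite addrA.
- by move=> *; rewrite addrC.
- by move=> *; rewrite add0r.
- by move=> *; rewrite addNr.
- by move=> *; rewrite scalerA.
- by move=> *; rewrite scale1r.
- by move=> *; rewrite scalerDr.
- by move=> *; rewrite scalerDl.
- by move=> *; rewrite lbrDl lbrZl.
- by move=> *; rewrite lbrDr lbrZr.
- by move=> *; rewrite lbrxx.
- by move=> *; rewrite lbr_jacobi.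
- by move=> *; rewrite linearP.
Qed.

Definition lie_lift_fun (x : lie V) : L := lie_eval (repr x).

Lemma lie_lift_class t : lie_lift_fun (free_lie_class t) = lie_eval t.
Proof. by apply: lie_eval_eq; exact: free_lie_reprP. Qed.

Fact lie_lift_linear : linear lie_lift_fun.
Proof.
move=> a x y; have [s ->] := free_lie_surj x; have [t ->] := free_lie_surj y.
by rewrite -free_lie_classZ -free_lie_classD !lie_lift_class.
Qed.

HB.instance Definition _ :=
  GRing.isLinear.Build rat (lie V) L _ lie_lift_fun lie_lift_linear.

Definition lie_lift : {linear lie V -> L} := lie_lift_fun.
Arguments lie_lift : simpl never.

Lemma lie_lift_gen v : lie_lift (lie_gen V v) = f v.
Proof. exact: lie_lift_class. Qed.

Lemma lie_lift_br x y : lie_lift (lbr x y) = lbr (lie_lift x) (lie_lift y).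
Proof.
have [s ->] := free_lie_surj x; have [t ->] := free_lie_surj y.
rewrite -[lbr _ _]free_lie_class_br [LHS]lie_lift_class /=.
by rewrite -[lie_eval s]lie_lift_class -[lie_eval t]lie_lift_class.
Qed.

End FreeLieLift.

(** The elements of [V] have degree 1: the degree [n] part of [lie V] is
    spanned by the [n]-fold brackets of elements of [V]. *)

Inductive lie_monomial (V : lmodType rat) : nat -> set (lie V) :=
| LieMonGen v : lie_monomial 1 (lie_gen V v)
| LieMonBr i j x y : lie_monomial i x -> lie_monomial j y ->
    lie_monomial (i + j) (lbr x y).

Definition lie_degree (V : lmodType rat) (n : nat) : set (lie V) :=
  lspan (@lie_monomial V n).

Section FreeLieGrading.
Variable V : lmodType rat.

Fact lie_degree_br i j (x y : lie V) :
  lie_degree i x -> lie_degree j y -> lie_degree (i + j) (lbr x y).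
Proof.
have S := @lspan_submod (lie V).
move=> + dy; move: x; apply: lspan_min.
  split=> [|a u v h1 h2] /=; first by rewrite lbr0l; case: (S (@lie_monomial V (i + j))).
  by rewrite lbrDl lbrZl; case: (S (@lie_monomial V (i + j))) => _; apply.
move=> x mx /=; move: y dy; apply: lspan_min.
  split=> [|a u v h1 h2] /=; first by rewrite lbr0r; case: (S (@lie_monomial V (i + j))).
  by rewrite lbrDr lbrZr; case: (S (@lie_monomial V (i + j))) => _; apply.
by move=> y my /=; apply: sub_lspan; exact: LieMonBr.
Qed.

Lemma lie_span (x : lie V) : lspan [set y | exists n, lie_degree n y] x.
Proof.
set D := (X in lspan X); have Dsub := lspan_submod D.
have Dn n y : lie_degree n y -> lspan D y by move=> ?; apply: sub_lspan; exists n.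
have [t ->] := free_lie_surj x; elim: t => {x}.
- by move=> v; apply: (Dn 1%N); apply: sub_lspan; exact: LieMonGen.
- by case: Dsub.
- by move=> s hs t ht; rewrite free_lie_classD; exact: (submodD Dsub).
- move=> s hs; have -> : free_lie_class (LieOpp s) = - free_lie_class s.
    exact: esym (free_lie_oppE s).
  exact: (submodN Dsub).
- by move=> a s hs; rewrite free_lie_classZ; exact: (submodZ _ Dsub).
- move=> s + t; rewrite free_lie_class_br => hs ht.
  move: (free_lie_class s) hs; apply: lspan_min.
    split=> [|a u v h1 h2] /=; first by rewrite lbr0l; case: Dsub.
    by rewrite lbrDl lbrZl; case: Dsub => _; apply.
  move=> u [i du] /=; move: (free_lie_class t) ht; apply: lspan_min.
    split=> [|a v w h1 h2] /=; first by rewrite lbr0r; case: Dsub.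
    by rewrite lbrDr lbrZr; case: Dsub => _; apply.
  by move=> v [j dv] /=; apply: (Dn (i + j)%N); exact: lie_degree_br.
Qed.

Let dbl : {linear V -> lie V} := 2 \*: lie_gen V.

Fact lie_lift_dbl n (x : lie V) :
  lie_degree n x -> lie_lift dbl x = 2 ^+ n *: x.
Proof.
move: x; apply: lspan_min.
  split=> [|a u v h1 h2] /=; first by rewrite raddf0 scaler0.
  by rewrite linearP /= h1 h2 scalerDr !scalerA mulrC.
move=> x mx; change (lie_lift dbl x = 2 ^+ n *: x).
elim: mx => [v|i j y z _ hy _ hz].
  by rewrite lie_lift_gen expr1.
by rewrite lie_lift_br hy hz lbrZl lbrZr scalerA exprD.
Qed.

Fact lie_is_grading : is_grading (@lie_degree V).
Proof.
split.
- by move=> n; exact: lspan_submod.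
- by move=> *; exact: lie_degree_br.
- move=> x; apply: lspan_components (lie_span x).
  by move=> n; exact: lspan_submod.
- elim=> [//|n IHn] u du su0.
  have dsum : \sum_(0 <= i < n) ((2 ^+ i - 2 ^+ n) *: u i) = 0.
    transitivity (\sum_(0 <= i < n.+1) ((2 ^+ i - 2 ^+ n) *: u i)).
      by rewrite [RHS]big_nat_recr //= subrr scale0r addr0.
    under eq_bigr => i _ do rewrite scalerBl -(lie_lift_dbl (du i)).
    rewrite big_split /= sumrN -scaler_sumr su0 scaler0 subr0.
    by rewrite -raddf_sum su0 raddf0.
  have u0 i : (i < n)%N -> u i = 0.
    move=> lt_in; have /IHn := dsum.
    move=> /(_ (fun i => submodZ _ (lspan_submod _) (du i)) i lt_in).
    move/eqP; rewrite scaler_eq0 subr_eq0 => /orP[|/eqP//].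
    by rewrite lt_eqF // ltr_eXn2l.
  move=> i; rewrite ltnS leq_eqVlt => /orP[/eqP->|/u0//].
  move: su0; rewrite big_nat_recr //= big1_seq ?add0r // => j.
  by rewrite mem_index_iota => /= /u0.
Qed.

Definition lie_grading : grading (lie V) := Grading lie_is_grading.

End FreeLieGrading.

Inductive group_term (X : Type) : Type :=
| GrpGen of X
| GrpOne
| GrpInv of group_term X
| GrpMul of group_term X & group_term X.
Arguments GrpOne {X}.

HB.instance Definition _ (X : Type) := gen_eqMixin (group_term X).
HB.instance Definition _ (X : Type) := gen_choiceMixin (group_term X).

Inductive group_eq (X : Type) : group_term X -> group_term X -> Prop :=
| GrpRefl t : group_eq t t
| GrpSym s t : group_eq s t -> group_eq t s
| GrpTrans s t r : group_eq s t -> group_eq t r -> group_eq s r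
| GrpCongInv s s' : group_eq s s' -> group_eq (GrpInv s) (GrpInv s')
| GrpCongMul s s' t t' : group_eq s s' -> group_eq t t' ->
    group_eq (GrpMul s t) (GrpMul s' t')
| GrpMulA r s t : group_eq (GrpMul r (GrpMul s t)) (GrpMul (GrpMul r s) t)
| GrpMul1l t : group_eq (GrpMul GrpOne t) t
| GrpMul1r t : group_eq (GrpMul t GrpOne) t
| GrpMulVl t : group_eq (GrpMul (GrpInv t) t) GrpOne
| GrpMulVr t : group_eq (GrpMul t (GrpInv t)) GrpOne.

Section FreeGroup.
Variable X : Type.

Definition group_rel : rel (group_term X) := fun s t => `[< group_eq s t >].

Fact group_rel_refl : reflexive group_rel.
Proof. by move=> t; apply/asboolP; exact: GrpRefl. Qed.
Fact group_rel_sym : symmetric group_rel.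
Proof. by move=> s t; apply/asboolP/asboolP => h; exact: GrpSym. Qed.
Fact group_rel_trans : transitive group_rel.
Proof.
by move=> s r t /asboolP rs /asboolP st; apply/asboolP; exact: GrpTrans st.
Qed.

Canonical group_equiv :=
  EquivRel group_rel group_rel_refl group_rel_sym group_rel_trans.

Definition free_group := {eq_quot group_equiv}.
HB.instance Definition _ := Choice.on free_group.

Definition free_group_class (t : group_term X) : free_group :=
  \pi_{eq_quot group_equiv} t.
Local Notation cl := free_group_class.

Lemma free_group_classP s t : cl s = cl t <-> group_eq s t.
Proof. by split=> [/eqmodP/asboolP|h]; last by apply/eqmodP/asboolP. Qed.

Lemma free_group_surj (x : free_group) : exists t, x = cl t.
Proof. by exists (repr x); rewrite /cl reprK. Qed.

Lemma free_group_reprP t : group_eq (repr (cl t)) t.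
Proof. by apply/free_group_classP; rewrite /cl reprK. Qed.

Definition free_group_inv (x : free_group) := cl (GrpInv (repr x)).
Definition free_group_mul (x y : free_group) := cl (GrpMul (repr x) (repr y)).

Fact free_group_invE t : free_group_inv (cl t) = cl (GrpInv t).
Proof. by apply/free_group_classP; apply: GrpCongInv; exact: free_group_reprP. Qed.
Fact free_group_mulE s t : free_group_mul (cl s) (cl t) = cl (GrpMul s t).
Proof. by apply/free_group_classP; apply: GrpCongMul; exact: free_group_reprP. Qed.

Let E := (free_group_invE, free_group_mulE).

Fact free_group_mulA : associative free_group_mul.
Proof.
move=> x y z; have [r ->] := free_group_surj x; have [s ->] := free_group_surj y.
have [t ->] := free_group_surj z; rewrite !E.
by apply/free_group_classP; exact: GrpMulA.
Qed.
Fact free_group_mul1g : left_id (cl GrpOne) free_group_mul.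
Proof.
move=> x; have [r ->] := free_group_surj x; rewrite !E.
by apply/free_group_classP; exact: GrpMul1l.
Qed.
Fact free_group_mulg1 : right_id (cl GrpOne) free_group_mul.
Proof.
move=> x; have [r ->] := free_group_surj x; rewrite !E.
by apply/free_group_classP; exact: GrpMul1r.
Qed.
Fact free_group_mulVg : left_inverse (cl GrpOne) free_group_inv free_group_mul.
Proof.
move=> x; have [r ->] := free_group_surj x; rewrite !E.
by apply/free_group_classP; exact: GrpMulVl.
Qed.
Fact free_group_mulgV : right_inverse (cl GrpOne) free_group_inv free_group_mul.
Proof.
move=> x; have [r ->] := free_group_surj x; rewrite !E.
by apply/free_group_classP; exact: GrpMulVr.
Qed.

HB.instance Definition _ := isGroup.Build free_group free_group_mulA
  free_group_mul1g free_group_mulg1 free_group_mulVg free_group_mulgV.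

Definition free_group_gen (x : X) : free_group := cl (GrpGen x).

End FreeGroup.

Definition is_normal_subgroup (G : groupType) (N : set G) : Prop :=
  [/\ N 1%g, forall x y, N x -> N y -> N (x * y)%g,
      forall x, N x -> N (x^-1)%g & forall x y, N x -> N (x ^ y)%g].

Definition normal_closure (G : groupType) (R : set G) : set G :=
  [set x | forall N : set G, is_normal_subgroup N -> R `<=` N -> N x].

Section GroupQuotient.
Variables (G : groupType) (R : set G).

Lemma normal_closure_normal : is_normal_subgroup (normal_closure R).
Proof.
split=> [N []//|x y hx hy|x hx|x y hx] N NN RN; have [_ NM NV NJ] := NN.
- by apply: NM; [exact: hx|exact: hy].
- by apply: NV; exact: hx.
- by apply: NJ; exact: hx.
Qed.

Lemma sub_normal_closure : R `<=` normal_closure R.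
Proof. by move=> x Rx N _; apply. Qed.

Definition group_quot_rel : rel G := fun x y => `[< normal_closure R (x^-1 * y)%g >].

Fact group_quot_rel_refl : reflexive group_quot_rel.
Proof.
by move=> x; apply/asboolP; rewrite mulVg; case: normal_closure_normal.
Qed.
Fact group_quot_rel_sym : symmetric group_quot_rel.
Proof.
have [_ _ NV _] := normal_closure_normal.
by move=> x y; apply/asboolP/asboolP => /NV; rewrite invgM invgK.
Qed.
Fact group_quot_rel_trans : transitive group_quot_rel.
Proof.
have [_ NM _ _] := normal_closure_normal.
move=> y x z /asboolP xy /asboolP yz; apply/asboolP.
by have := NM _ _ xy yz; rewrite -mulgA mulVKg.
Qed.

Canonical group_quot_equiv := EquivRel group_quot_rel
  group_quot_rel_refl group_quot_rel_sym group_quot_rel_trans.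

Definition group_quot := {eq_quot group_quot_equiv}.
HB.instance Definition _ := Choice.on group_quot.

Definition group_class (x : G) : group_quot := \pi_{eq_quot group_quot_equiv} x.
Local Notation cl := group_class.

Lemma group_classP x y : cl x = cl y <-> normal_closure R (x^-1 * y)%g.
Proof. by split=> [/eqmodP/asboolP|h]; last by apply/eqmodP/asboolP. Qed.

Lemma group_class_surj (x : group_quot) : exists t, x = cl t.
Proof. by exists (repr x); rewrite /cl reprK. Qed.

Lemma group_reprP t : normal_closure R ((repr (cl t))^-1 * t)%g.
Proof. by apply/group_classP; rewrite /cl reprK. Qed.

Definition group_quot_inv (x : group_quot) := cl (repr x)^-1%g.
Definition group_quot_mul (x y : group_quot) := cl (repr x * repr y)%g.

Fact group_quot_mulE s t : group_quot_mul (cl s) (cl t) = cl (s * t)%g.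
Proof.
have [_ NM _ NJ] := normal_closure_normal; apply/group_classP.
have := NM _ _ (group_reprP t) (NJ _ t (group_reprP s)).
by rewrite /conjg invgM !mulgA mulgK.
Qed.

Fact group_quot_invE t : group_quot_inv (cl t) = cl t^-1%g.
Proof.
have [_ _ NV NJ] := normal_closure_normal; apply/group_classP.
have := NJ _ (t^-1)%g (NV _ (group_reprP t)).
by rewrite /conjg invgM !invgK !mulgA mulgV mul1g.
Qed.

Let E := (group_quot_invE, group_quot_mulE).

Fact group_quot_mulA : associative group_quot_mul.
Proof.
move=> x y z; have [r ->] := group_class_surj x; have [s ->] := group_class_surj y.
by have [t ->] := group_class_surj z; rewrite !E mulgA.
Qed.
Fact group_quot_mul1g : left_id (cl 1%g) group_quot_mul.
Proof. by move=> x; have [r ->] := group_class_surj x; rewrite !E mul1g. Qed.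
Fact group_quot_mulg1 : right_id (cl 1%g) group_quot_mul.
Proof. by move=> x; have [r ->] := group_class_surj x; rewrite !E mulg1. Qed.
Fact group_quot_mulVg : left_inverse (cl 1%g) group_quot_inv group_quot_mul.
Proof. by move=> x; have [r ->] := group_class_surj x; rewrite !E mulVg. Qed.
Fact group_quot_mulgV : right_inverse (cl 1%g) group_quot_inv group_quot_mul.
Proof. by move=> x; have [r ->] := group_class_surj x; rewrite !E mulgV. Qed.

HB.instance Definition _ := isGroup.Build group_quot group_quot_mulA
  group_quot_mul1g group_quot_mulg1 group_quot_mulVg group_quot_mulgV.

End GroupQuotient.

Definition presented_group (X : Type) (R : set (free_group X)) : groupType :=
  group_quot R.

Definition expgz (G : groupType) (x : G) (n : int) : G :=
  match n with Posz m => x ^+ m | Negz m => x ^- m.+1 end%g.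

Lemma lclass_lin (V : lmodType rat) (S : set V) a u v :
  lclass S (a *: u + v) = a *: lclass S u + lclass S v.
Proof. exact: linearP. Qed.

Lemma ker_val_lin (U V : lmodType rat) (f : {linear U -> V}) a (x y : ker f) :
  ker_val (a *: x + y) = a *: ker_val x + ker_val y.
Proof. exact: (linearP (\val : ker f -> U)). Qed.

Lemma ker_inj (U V : lmodType rat) (f : {linear U -> V}) :
  injective (@ker_val _ _ f).
Proof. exact: val_inj. Qed.

Lemma ker_valP (U V : lmodType rat) (f : {linear U -> V}) (x : ker f) :
  f (ker_val x) = 0.
Proof. by case: x => u fu0; apply/eqP; exact: fu0. Qed.

Lemma lext_comp (K K' : choiceType) (V : lmodType rat) (f : K' -> V)
    (g : K -> {malg rat[K']}) (c : {malg rat[K]}) :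
  lext f (lext g c) = lext (fun k => lext f (g k)) c.
Proof.
rewrite {2}/lext raddf_sum; apply: eq_bigr => k _.
exact: (linearZ_LR (lext f)).
Qed.

Lemma lext_funP (K : choiceType) (c : {malg rat[K]}) :
  linear (fun f : K -> rat^o => lext f c).
Proof.
move=> a f g; rewrite /lext scaler_sumr -big_split; apply: eq_bigr => k _ /=.
rewrite !(addrfctE, scalrfctE) /= /GRing.scale /=; by ring.
Qed.

Lemma lext0l (K : choiceType) (c : {malg rat[K]}) :
  lext (0 : K -> rat^o) c = 0.
Proof. by rewrite /lext big1 // => k _; rewrite scaler0. Qed.

(** The pairing of the cohomology of a complex of cochains [K -> rat] with the
    homology of a complex of chains [{malg rat[K]}], by evaluation of cocycles
    on cycles; see [kron_class]. *)

Section Kronecker.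
Variables (K : choiceType) (A C A' C' : lmodType rat).
Variables (d : {linear A -> (K -> rat^o)}) (e : {linear (K -> rat^o) -> C}).
Variables (d' : {linear A' -> {malg rat[K]}}) (e' : {linear {malg rat[K]} -> C'}).

Definition kron (x : homology d e) (c : homology d' e') : rat^o :=
  lext (ker_val (lrepr x)) (ker_val (lrepr c)).

Hypothesis ortho_cobd : forall a z, e' z = 0 -> lext (d a) z = 0.
Hypothesis ortho_bd : forall f b, e f = 0 -> lext f (d' b) = 0.

Lemma kron_class (f : ker e) (c : ker e') :
  kron (lclass _ f) (lclass _ c) = lext (ker_val f) (ker_val c).
Proof.
rewrite /kron; set f' := lrepr _; set c' := lrepr _.
have hf : lext (ker_val (f' - f)) (ker_val c') = 0.
  move: (f' - f) (lreprP (S := [set z : ker e | exists a, ker_val z = d a]) f).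
  apply: lspan_min => [|z [a /= ->]]; last exact/ortho_cobd/ker_valP.
  pose F (u : ker e) := lext (ker_val u) (ker_val c').
  split=> [|a u v]; first exact: lext0l.
  change (F u = 0 -> F v = 0 -> F (a *: u + v) = 0); rewrite /F ker_val_lin.
  by rewrite lext_funP => -> ->; rewrite scaler0 addr0.
have hc : lext (ker_val f) (ker_val (c' - c)) = 0.
  move: (c' - c) (lreprP (S := [set z : ker e' | exists a, ker_val z = d' a]) c).
  apply: lspan_min => [|z [a /= ->]]; last exact/ortho_bd/ker_valP.
  pose F (u : ker e') := lext (ker_val f) (ker_val u).
  split=> [|a u v]; first exact: raddf0.
  change (F u = 0 -> F v = 0 -> F (a *: u + v) = 0); rewrite /F ker_val_lin.
  by rewrite linearP /= => -> ->; rewrite scaler0 addr0.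
have E1 : ker_val f' = 1 *: ker_val (f' - f) + ker_val f.
  by rewrite -ker_val_lin scale1r subrK.
have E2 : ker_val c' = 1 *: ker_val (c' - c) + ker_val c.
  by rewrite -ker_val_lin scale1r subrK.
rewrite E1 lext_funP hf scaler0 add0r E2 linearP /= hc.
by rewrite scaler0 add0r.
Qed.

End Kronecker.

Arguments kron {K A C A' C' d e d' e'} x c.

Section GroupHomology.
Variable G : groupType.

(** The bar complex with trivial rational coefficients; the differentials
    between degrees 0 and 1 vanish. *)

Definition bd1 : {linear {malg rat[G]} -> rat^o} := \0.

Definition bd2 : {linear {malg rat[(G * G)%type]} -> {malg rat[G]}} :=
  lext (fun p => << p.2 >> - << (p.1 * p.2)%g >> + << p.1 >>).

Definition bd3 :
    {linear {malg rat[(G * G * G)%type]} -> {malg rat[(G * G)%type]}} :=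
  lext (fun p => let: (a, b, c) := p in
    << (b, c) >> - << ((a * b)%g, c) >> + << (a, (b * c)%g) >> - << (a, b) >>).

Definition cobd0 : {linear rat^o -> (G -> rat^o)} := \0.

Definition cobd1_fun (f : G -> rat^o) : G * G -> rat^o :=
  fun p => f p.2 - f (p.1 * p.2)%g + f p.1.

Definition cobd2_fun (f : G * G -> rat^o) : G * G * G -> rat^o :=
  fun p => let: (a, b, c) := p in
    f (b, c) - f ((a * b)%g, c) + f (a, (b * c)%g) - f (a, b).

Fact cobd1_linear : linear cobd1_fun.
Proof.
move=> a f g; apply/funext => p.
rewrite /cobd1_fun !(addrfctE, scalrfctE) /= /GRing.scale /=.
by ring.
Qed.

Fact cobd2_linear : linear cobd2_fun.
Proof.
move=> a f g; apply/funext => -[[x y] z].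
rewrite /cobd2_fun !(addrfctE, scalrfctE) /= /GRing.scale /=.
by ring.
Qed.

HB.instance Definition _ := GRing.isLinear.Build rat (G -> rat^o)
  (G * G -> rat^o) _ cobd1_fun cobd1_linear.
HB.instance Definition _ := GRing.isLinear.Build rat (G * G -> rat^o)
  (G * G * G -> rat^o) _ cobd2_fun cobd2_linear.

Definition cobd1 : {linear (G -> rat^o) -> (G * G -> rat^o)} := cobd1_fun.
Definition cobd2 : {linear (G * G -> rat^o) -> (G * G * G -> rat^o)} :=
  cobd2_fun.

Definition homology1 := homology bd2 bd1.
Definition homology2 := homology bd3 bd2.
Definition cohomology1 := homology cobd0 cobd1.
Definition cohomology2 := homology cobd1 cobd2.

Lemma lext_cobd1 (f : G -> rat^o) c : lext (cobd1 f) c = lext f (bd2 c).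
Proof.
rewrite [bd2 c]/= lext_comp; congr lext; apply/funext => p.
by rewrite linearD linearB /= !lextU.
Qed.

Lemma lext_cobd2 (f : G * G -> rat^o) c : lext (cobd2 f) c = lext f (bd3 c).
Proof.
rewrite [bd3 c]/= lext_comp; congr lext; apply/funext => -[[x y] z].
by rewrite linearB linearD linearB /= !lextU.
Qed.

Lemma bd2_bd3 c : bd2 (bd3 c) = 0.
Proof.
rewrite [bd3 c]/= [bd2 _]/= lext_comp (_ : (fun k => _) = fun=> 0).
  by rewrite /lext big1 // => k _; rewrite scaler0.
apply/funext => -[[x y] z].
rewrite linearB linearD linearB /= !lextU /= mulgA.
apply/eqP; rewrite subr_eq0 addrAC subr_eq; apply/eqP.
rewrite [LHS](AC (3*3) (1*3*5*6*(4*2))) [RHS](AC (3*3) (4*1*5*3*(6*2))) /=.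
by rewrite !subrr !addr0.
Qed.

Lemma cobd2_cobd1 f : cobd2 (cobd1 f) = 0.
Proof.
apply/funext => -[[x y] z]; rewrite /= /cobd2_fun /cobd1_fun /= mulgA.
by rewrite -[RHS]/(0 : rat^o); ring.
Qed.

Definition kron1 : cohomology1 -> homology1 -> rat^o := kron.
Definition kron2 : cohomology2 -> homology2 -> rat^o := kron.

Lemma kron1_class (f : ker cobd1) (c : ker bd1) :
  kron1 (lclass _ f) (lclass _ c) = lext (ker_val f) (ker_val c).
Proof.
apply: kron_class => [a z _|h b fh0].
  by rewrite /lext big1 // => k _; rewrite scaler0.
by rewrite -lext_cobd1 fh0 lext0l.
Qed.

Lemma kron2_class (f : ker cobd2) (c : ker bd2) :
  kron2 (lclass _ f) (lclass _ c) = lext (ker_val f) (ker_val c).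
Proof.
apply: kron_class => [a z z0|h b fh0].
  by rewrite lext_cobd1 z0 raddf0.
by rewrite -lext_cobd2 fh0 lext0l.
Qed.

Lemma kron1_linearl c : linear (kron1^~ c).
Proof.
move=> a x y /=; rewrite -(lreprK x) -(lreprK y) -(lreprK c).
rewrite -lclass_lin !kron1_class ker_val_lin; exact: lext_funP.
Qed.

Lemma kron1_linearr f : linear (kron1 f).
Proof.
move=> a x y /=; rewrite -(lreprK x) -(lreprK y) -(lreprK f).
rewrite -lclass_lin !kron1_class ker_val_lin; exact: linearP.
Qed.

Definition cup_cochain (f g : G -> rat^o) : G * G -> rat^o :=
  fun p => f p.1 * g p.2.

Fact cocycle1M (f : ker cobd1) x y :
  ker_val f (x * y)%g = ker_val f x + ker_val f y.
Proof.
have /(congr1 (fun h => h (x, y))) /= := ker_valP f.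
rewrite /cobd1_fun /= => /eqP; rewrite addrAC subr_eq0 => /eqP <-.
by rewrite addrC.
Qed.

Fact cup_subproof (f g : ker cobd1) :
  cup_cochain (ker_val f) (ker_val g) \in kerp cobd2.
Proof.
have E : cobd2 (cup_cochain (ker_val f) (ker_val g)) = 0; last first.
  by rewrite inE E.
apply/funext => -[[x y] z]; rewrite /= /cobd2_fun /cup_cochain /=.
by rewrite !cocycle1M -[RHS]/(0 : rat^o); ring.
Qed.

Definition cup (x y : cohomology1) : cohomology2 :=
  lclass _ (Ker (cup_subproof (lrepr x) (lrepr y))).

Fact lrepr_cohomology1 (f : ker cobd1) :
  lrepr (lclass [set z : ker cobd1 | exists a, ker_val z = cobd0 a] f) = f.
Proof.
apply/eqP; rewrite -subr_eq0; apply/eqP.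
move: (_ - _) (lreprP (S := [set z : ker cobd1 | exists a, ker_val z = cobd0 a]) f).
apply: lspan_min => [|z [a /= za]]; last exact: val_inj.
by split=> // a u v /= -> ->; rewrite scaler0 addr0.
Qed.

Lemma cup_class (f g : ker cobd1) :
  cup (lclass _ f) (lclass _ g) = lclass _ (Ker (cup_subproof f g)).
Proof. by congr lclass; apply: val_inj; rewrite /= !lrepr_cohomology1. Qed.

Lemma cup_alternating : is_alternating cup.
Proof.
split=> [z a x y|z a x y|x].
- rewrite -(lreprK x) -(lreprK y) -(lreprK z) -lclass_lin !cup_class -lclass_lin.
  congr lclass; apply: ker_inj.
  rewrite [RHS]ker_val_lin -[LHS]/(cup_cochain (ker_val _) (ker_val _)) ker_val_lin.
  apply/funext => p; rewrite /cup_cochain !(addrfctE, scalrfctE) /= /GRing.scale /=.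
  by ring.
- rewrite -(lreprK x) -(lreprK y) -(lreprK z) -lclass_lin !cup_class -lclass_lin.
  congr lclass; apply: ker_inj.
  rewrite [RHS]ker_val_lin -[LHS]/(cup_cochain (ker_val _) (ker_val _)) ker_val_lin.
  apply/funext => p; rewrite /cup_cochain !(addrfctE, scalrfctE) /= /GRing.scale /=.
  by ring.
- rewrite -(lreprK x) cup_class; apply: lclass0; apply: sub_lspan.
  exists (fun u => - (2^-1) * (ker_val (lrepr x) u) ^+ 2).
  apply/funext => -[u v] /=; rewrite /cup_cochain /cobd1_fun /= cocycle1M.
  by field.
Qed.

Definition cup2 : ext2 cohomology1 -> cohomology2 := ext2_lift cup.

(** The pairing of the exterior squares: the pairing of [f /\ g] with [u /\ v]
    is the determinant [f(u) g(v) - f(v) g(u)]. *)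

Definition ext2_kron (x : ext2 cohomology1) (w : ext2 homology1) : rat^o :=
  ext2_lift (fun f g => ext2_lift (fun u v =>
    kron1 f u * kron1 g v - kron1 f v * kron1 g u) w) x.

Fact ext2_kron_alternating f g : is_alternating
  (fun u v => kron1 f u * kron1 g v - kron1 f v * kron1 g u : rat^o).
Proof.
split=> [w a u v|w a u v|v]; last by rewrite subrr.
- by rewrite !kron1_linearr /GRing.scale /=; ring.
- by rewrite !kron1_linearr /GRing.scale /=; ring.
Qed.

Lemma ext2_kron_wedge f g u v : ext2_kron (wedge f g) (wedge u v) =
  kron1 f u * kron1 g v - kron1 f v * kron1 g u.
Proof.
rewrite /ext2_kron ext2_lift_wedge.
  by rewrite ext2_lift_wedge //; exact: ext2_kron_alternating.
have linE (B B' : homology1 -> homology1 -> rat^o) a x :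
    ext2_lift (fun u v => a *: B u v + B' u v) x =
    a *: ext2_lift B x + ext2_lift B' x.
  rewrite /ext2_lift -lext_funP.
  by congr lext; apply/funext => p.
split=> [h a f1 f2|h a f1 f2|h].
- rewrite -linE; congr ext2_lift; apply/funext => u'; apply/funext => v'.
  by rewrite !kron1_linearl /GRing.scale /=; ring.
- rewrite -linE; congr ext2_lift; apply/funext => u'; apply/funext => v'.
  by rewrite !kron1_linearl /GRing.scale /=; ring.
- rewrite /ext2_lift /lext big1 // => p _.
  by rewrite [kron1 h p.1 * _]mulrC subrr scaler0.
Qed.

(** [w] is the image of [c] under the dual [homology2 -> ext2 homology1] of
    [cup2]: [homology2] maps to the dual of [cohomology2] by [kron2], and, for
    finitely generated [G], [ext2_kron] identifies [ext2 homology1] with the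
    dual of [ext2 cohomology1]. *)

Definition is_cup2_dual (c : homology2) (w : ext2 homology1) : Prop :=
  forall x : ext2 cohomology1, ext2_kron x w = kron2 (cup2 x) c.

Definition ext2_lie (V : lmodType rat) : ext2 V -> lie V :=
  ext2_lift (fun u v => lbr (lie_gen V u) (lie_gen V v)).

Lemma ext2_lie_wedge (V : lmodType rat) (u v : V) :
  ext2_lie (wedge u v) = lbr (lie_gen V u) (lie_gen V v).
Proof.
apply: ext2_lift_wedge; split=> [w a x y|w a x y|x].
- by rewrite linearP lbrDl lbrZl.
- by rewrite linearP lbrDr lbrZr.
- exact: lbrxx.
Qed.

Definition holonomy_rels : set (lie homology1) :=
  [set r | exists (c : homology2) (w : ext2 homology1), is_cup2_dual c w /\ r = ext2_lie w].

Definition holonomy : lieType := lie_quot holonomy_rels.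

Fact holonomy_homogeneous : is_homogeneous (lie_grading homology1) holonomy_rels.
Proof.
move=> r Rr; apply: sub_lspan; split; first exact: sub_ideal_gen.
move: Rr => [c [w [_ ->]]]; exists 2%N; apply: submod_sum.
  exact: lspan_submod.
move=> p _; apply: (submodZ _ (lspan_submod _)); apply: sub_lspan.
exact: (LieMonBr (LieMonGen _) (LieMonGen _)).
Qed.

Definition holonomy_grading : grading holonomy :=
  lie_quot_grading holonomy_homogeneous.

End GroupHomology.

Inductive seifert_gen (g s : nat) : Type :=
| SeifertX of 'I_g
| SeifertY of 'I_g
| SeifertZ of 'I_s
| SeifertH.
Arguments SeifertX {g s} i.
Arguments SeifertY {g s} i.
Arguments SeifertZ {g s} j.
Arguments SeifertH {g s}.

Section Seifert.
Variables (g : nat) (b : int) (s : nat) (alpha beta : 'I_s -> int).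

Let x (i : 'I_g) := free_group_gen (@SeifertX g s i).
Let y (i : 'I_g) := free_group_gen (@SeifertY g s i).
Let z (j : 'I_s) := free_group_gen (@SeifertZ g s j).
Let h := free_group_gen (@SeifertH g s).

(** Here [[~ a, b] = a^-1 * b^-1 * a * b]; the convention [a * b * a^-1 * b^-1]
    gives an isomorphic group, by inverting all [x i] and [y i]. *)

Inductive seifert_relators : set (free_group (seifert_gen g s)) :=
| SeifertCentral w : seifert_relators [~ h, w]%g
| SeifertBase : seifert_relators
    (\prod_(i < g) [~ x i, y i] * \prod_(j < s) z j * (expgz h b)^-1)%g
| SeifertFiber j : seifert_relators
    (expgz (z j) (alpha j) * expgz h (beta j))%g.

Definition seifert_group : groupType := presented_group seifert_relators.

Definition seifert_euler : rat :=
  - b%:~R - \sum_(j < s) (beta j)%:~R / (alpha j)%:~R.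

End Seifert.

(** The free Lie algebra on a set [X] is that on the vector space with basis
    [X]. *)

Definition lie_on (X : choiceType) : lieType := lie {malg rat[X]}.

Definition lie_var (X : choiceType) (x : X) : lie_on X :=
  lie_gen {malg rat[X]} << x >>.

Definition lie_on_grading (X : choiceType) : grading (lie_on X) :=
  lie_grading {malg rat[X]}.

(** In [surface_gen g], [inl i] is [x_i] and [inr i] is [y_i]; in
    [surface_gen_h g], [None] is [h]. *)

Definition surface_gen (g : nat) : choiceType := ('I_g + 'I_g)%type.
Definition surface_gen_h (g : nat) : choiceType := option (surface_gen g).

Section SurfaceLie.
Variable g : nat.

Let x (i : 'I_g) : lie_on (surface_gen_h g) := lie_var (Some (inl i)).
Let y (i : 'I_g) : lie_on (surface_gen_h g) := lie_var (Some (inr i)).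
Let h : lie_on (surface_gen_h g) := lie_var None.

Inductive surface_lie_rels : set (lie_on (surface_gen_h g)) :=
| SurfaceSum : surface_lie_rels (\sum_(i < g) lbr (x i) (y i))
| SurfaceCentral u : surface_lie_rels (lbr h u).

Definition surface_lie : lieType := lie_quot surface_lie_rels.

Fact surface_lie_homogeneous :
  is_homogeneous (lie_on_grading (surface_gen_h g)) surface_lie_rels.
Proof.
have var1 v : lie_on_grading (surface_gen_h g) 1%N (lie_var v).
  by apply: sub_lspan; exact: LieMonGen.
have gP := gradingP (lie_on_grading (surface_gen_h g)).
move=> r [|u].
  apply: sub_lspan; split; first by apply: sub_ideal_gen; exact: SurfaceSum.
  exists 2%N; apply: submod_sum; first exact: (grading_submod gP).
  by move=> i _; apply: (grading_lbr gP (i := 1) (j := 1)); exact: var1.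
have [n [w [gw ->]]] := grading_sum gP u.
have -> : lbr h (\sum_(0 <= i < n) w i) = \sum_(0 <= i < n) lbr h (w i).
  apply: (big_morph (lbr h) (id1 := 0)); last exact: lbr0r.
  by move=> p q; rewrite lbrDr.
apply: submod_sum; first exact: lspan_submod.
move=> i _; apply: sub_lspan; split.
  by apply: sub_ideal_gen; exact: SurfaceCentral.
by exists (1 + i)%N; apply: (grading_lbr gP); [exact: var1|exact: gw].
Qed.

Definition surface_lie_grading : grading surface_lie :=
  lie_quot_grading surface_lie_homogeneous.

End SurfaceLie.

(* Main.v *)
From HB Require Import structures.
Require Import Defs.
From mathcomp Require Import all_boot all_order all_algebra.
From mathcomp Require Import ring.
From mathcomp Require Import boolp classical_sets functions.
From mathcomp.multinomials Require Import monalg.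
Import Order.TTheory GRing.Theory Num.Theory.
Set Implicit Arguments.
Unset Strict Implicit.
Unset Printing Implicit Defensive.
Local Open Scope classical_set_scope.
Local Open Scope ring_scope.

(** Call [m : G -> M] a quasihomomorphism for an alternating biadditive [k] when
    [m (a b) = m a + m b + k a b], that is, when [m] lifts [G] to a Heisenberg
    extension of [G] by [M].  Then [m [a, b] = 2 k a b], and the relators of the
    Seifert group give [2 sum_i k x_i y_i + e m(h) = 0] as soon as [k] vanishes on
    the pairs [(z_i, z_j)] and [(z_j, h)]; conversely, values on the generators
    which satisfy this equation extend if [k] vanishes on all pairs which
    involve [h] or some [z_j].
    With [k = 0] this computes [H_1], where [h] is nonzero only if [e = 0].
    With [k] the alternating form of a cup product of classes that vanish on [h],
    all such products vanish if [e <> 0], and they are multiples of one class,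
    with coefficients the values of the form on [sum_i x_i /\ y_i], if [e = 0].
    With values in chains, it yields a 2-cycle dual to [sum_i x_i /\ y_i] when
    [e = 0]; the classes [h /\ a] come from the tori spanned by [h] and [a]. *)

(** * Quasihomomorphisms and their values on commutators and relators *)

Record alt_bihom (G : groupType) (M : lmodType rat) (k : G -> G -> M) : Prop :=
  AltBihom {
    bihomMl : forall a b c, k (a * b)%g c = k a c + k b c;
    bihomMr : forall a b c, k a (b * c)%g = k a b + k a c;
    bihomxx : forall a, k a a = 0
  }.

Definition quasihom (G : groupType) (M : lmodType rat) (k : G -> G -> M)
    (m : G -> M) : Prop := forall a b, m (a * b)%g = m a + m b + k a b.

Section Quasihom.
Variables (G : groupType) (M : lmodType rat) (k : G -> G -> M) (m : G -> M).
Hypotheses (kP : alt_bihom k) (mP : quasihom k m).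

Lemma bihom1l a : k 1%g a = 0.
Proof. by apply: (addIr (k 1%g a)); rewrite -(bihomMl kP) mulg1 add0r. Qed.

Lemma bihom1r a : k a 1%g = 0.
Proof. by apply: (addIr (k a 1%g)); rewrite -(bihomMr kP) mulg1 add0r. Qed.

Lemma bihomVl a b : k a^-1%g b = - k a b.
Proof. by apply: (addIr (k a b)); rewrite -(bihomMl kP) mulVg bihom1l addNr. Qed.

Lemma bihomVr a b : k a b^-1%g = - k a b.
Proof. by apply: (addIr (k a b)); rewrite -(bihomMr kP) mulVg bihom1r addNr. Qed.

Lemma bihomC a b : k b a = - k a b.
Proof.
apply/eqP; rewrite -addr_eq0; have := bihomxx kP (a * b)%g.
rewrite (bihomMl kP) !(bihomMr kP) !(bihomxx kP) add0r addr0.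
by move/eqP; rewrite addrC.
Qed.

Lemma bihomXl0 a b n : k a b = 0 -> k (expgz a n) b = 0.
Proof.
move=> kab; have kX p : k (a ^+ p)%g b = 0.
  by elim: p => [|p IHp]; rewrite ?expg0 ?bihom1l // expgS (bihomMl kP) kab IHp addr0.
by case: n => n /=; rewrite ?bihomVl kX ?oppr0.
Qed.

Lemma bihomXr0 a b n : k a b = 0 -> k a (expgz b n) = 0.
Proof. by move=> kab; rewrite bihomC bihomXl0 ?oppr0 // bihomC kab oppr0. Qed.

Lemma quasihom1 : m 1%g = 0.
Proof.
by apply: (addIr (m 1%g)); have := mP 1%g 1%g; rewrite mulg1 bihom1l addr0 add0r.
Qed.

Lemma quasihomV a : m a^-1%g = - m a.
Proof.
apply: (addIr (m a)); rewrite addNr; have := mP a^-1%g a.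
by rewrite mulVg quasihom1 bihomVl (bihomxx kP) oppr0 addr0.
Qed.

Lemma quasihomXz a n : m (expgz a n) = n%:~R *: m a.
Proof.
have mX p : m (a ^+ p)%g = p%:R *: m a.
  elim: p => [|p IHp]; first by rewrite expg0 quasihom1 scale0r.
  rewrite expgS mP (bihomXr0 p%:Z) ?(bihomxx kP) // addr0 IHp.
  by rewrite -[p.+1]add1n natrD scalerDl scale1r.
case: n => p /=; first exact: mX.
by rewrite quasihomV mX NegzE intrN scaleNr.
Qed.

(** The values at [a * b] and [b * a] differ by [k a b - k b a]. The correction term of the product
    of [(b * a)^-1] and [a * b] vanishes because [k] is alternating. *)
Lemma quasihomR a b : m [~ a, b]%g = 2 *: k a b.
Proof.
have -> : [~ a, b]%g = ((b * a)^-1 * (a * b))%g.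
  by rewrite commgEl /conjg invgM !mulgA.
rewrite mP quasihomV !mP bihomVl (bihomMl kP) !(bihomMr kP) !(bihomxx kP).
rewrite (bihomC a b) add0r addr0 addNr oppr0 addr0.
rewrite !opprD opprK addrACA [- m b - _]addrC -opprD addNr add0r.
by rewrite -mulr2n scaler_nat.
Qed.

Lemma bihomRl a b c : k [~ a, b]%g c = 0.
Proof.
rewrite commgEl /conjg !(bihomMl kP) !bihomVl.
by rewrite [X in _ + X]addrCA addNr addr0 addNr.
Qed.

Lemma bihom_prodl (I : Type) (r : seq I) (F : I -> G) c :
  (forall i, k (F i) c = 0) -> k (\prod_(i <- r) F i)%g c = 0.
Proof.
move=> kF; elim: r => [|i r IHr]; first by rewrite big_nil bihom1l.
by rewrite big_cons (bihomMl kP) kF IHr addr0.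
Qed.

Lemma quasihom_prod (I : Type) (r : seq I) (F : I -> G) :
  (forall i j, k (F i) (F j) = 0) ->
  m (\prod_(i <- r) F i)%g = \sum_(i <- r) m (F i).
Proof.
move=> kF; elim: r => [|i r IHr]; first by rewrite !big_nil quasihom1.
rewrite !big_cons mP IHr bihomC bihom_prodl ?oppr0 ?addr0 //.
Qed.

Lemma quasihom_prod_comm g (x y : 'I_g -> G) :
  m (\prod_(i < g) [~ x i, y i])%g = 2 *: \sum_(i < g) k (x i) (y i).
Proof.
rewrite quasihom_prod; last by move=> i j; rewrite bihomRl.
by rewrite scaler_sumr; apply: eq_bigr => i _; rewrite quasihomR.
Qed.

(** Commutators lie in the radical of [k], so the first factor contributes no correction term; the
    two assumptions remove the corrections between the other factors. *)
Lemma quasihom_base_relator g s b (x y : 'I_g -> G) (z : 'I_s -> G) (h : G) :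
  (forall i j, k (z i) (z j) = 0) -> (forall j, k (z j) h = 0) ->
  m (\prod_(i < g) [~ x i, y i] * \prod_(j < s) z j * (expgz h b)^-1)%g =
  2 *: (\sum_(i < g) k (x i) (y i)) + \sum_(j < s) m (z j) - b%:~R *: m h.
Proof.
move=> kzz kzh.
have kc c : k (\prod_(i < g) [~ x i, y i])%g c = 0.
  by apply: bihom_prodl => i; rewrite bihomRl.
rewrite !mP quasihomV quasihomXz bihomVr (bihomMl kP) !kc quasihom_prod_comm.
rewrite quasihom_prod // bihom_prodl ?addr0 ?oppr0 ?addr0 //.
by move=> j; rewrite bihomXr0.
Qed.

Lemma quasihom_fiber_relator (z h : G) (a b : int) : k z h = 0 ->
  m (expgz z a * expgz h b)%g = a%:~R *: m z + b%:~R *: m h.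
Proof.
by move=> kzh; rewrite mP !quasihomXz bihomXr0 ?addr0 // bihomXl0.
Qed.

End Quasihom.

(** * Extension of values on generators to a free group *)

Section FreeQuasihom.
Variables (X : Type) (G : groupType) (M : lmodType rat).

Lemma free_groupM s t :
  free_group_class (GrpMul s t) =
    (free_group_class s * free_group_class t :> free_group X)%g.
Proof. exact: esym (free_group_mulE s t). Qed.

Lemma free_groupV s :
  free_group_class (GrpInv s) = (free_group_class s)^-1%g :> free_group X.
Proof. exact: esym (free_group_invE s). Qed.

Lemma free_group_ind (P : free_group X -> Prop) :
  (forall x, P (free_group_gen x)) -> P 1%g -> (forall a, P a -> P a^-1%g) ->
  (forall a b, P a -> P b -> P (a * b)%g) -> forall a, P a.
Proof.
move=> Pg P1 PV PM a; have [t ->] := free_group_surj a.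
elim: t => [x||s Ps|s Ps t Pt]; first exact: Pg.
- exact: P1.
- by rewrite free_groupV; exact: PV.
- by rewrite free_groupM; exact: PM.
Qed.

Variables (c : free_group X -> G) (k : G -> G -> M) (v : X -> M).
Hypotheses (cM : {morph c : a b / (a * b)%g >-> (a * b)%g}) (kP : alt_bihom k).

Let kc a b := k (c a) (c b).

Lemma alt_bihom_comp : alt_bihom kc.
Proof.
split=> [a b d|a b d|a]; rewrite /kc ?cM ?(bihomMl kP) ?(bihomMr kP) //.
exact: bihomxx kP _.
Qed.

(** This is the [M]-coordinate of the word in the Heisenberg extension of [G] by [M] with cocycle
    [k]. Inverses need no correction since [k a a = 0]. *)
Fixpoint quasihom_eval (t : group_term X) : M :=
  match t with
  | GrpGen x => v x
  | GrpOne => 0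
  | GrpInv s => - quasihom_eval s
  | GrpMul s t => quasihom_eval s + quasihom_eval t
      + kc (free_group_class s) (free_group_class t)
  end.

Lemma quasihom_eval_eq s t :
  group_eq s t -> quasihom_eval s = quasihom_eval t.
Proof.
have kcP := alt_bihom_comp.
elim=> //= {s t}.
- by move=> s t r _ -> _ ->.
- by move=> s t _ ->.
- move=> s s' t t' ss' -> tt' ->; move/free_group_classP: ss' => ->.
  by move/free_group_classP: tt' => ->.
- move=> r s t; rewrite !free_groupM (bihomMl kcP) (bihomMr kcP).
  by rewrite [LHS](AC (1*3*2) (1*2*5*3*(6*4))).
- by move=> t; rewrite (bihom1l kcP) addr0 add0r.
- by move=> t; rewrite (bihom1r kcP) !addr0.
- by move=> t; rewrite free_groupV (bihomVl kcP) (bihomxx kcP) oppr0 addr0 addNr.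
- by move=> t; rewrite free_groupV (bihomVr kcP) (bihomxx kcP) oppr0 addr0 addrN.
Qed.

Lemma free_quasihom : exists m : free_group X -> M,
  quasihom kc m /\ forall x, m (free_group_gen x) = v x.
Proof.
exists (fun a => quasihom_eval (repr a)); split=> [a b|x]; last first.
  exact: quasihom_eval_eq (free_group_reprP _).
have [s ->] := free_group_surj a; have [t ->] := free_group_surj b.
rewrite -free_groupM !(quasihom_eval_eq (free_group_reprP _)) //.
Qed.

End FreeQuasihom.

(** * Descent of quasihomomorphisms to presented groups *)

Section PresentedGroup.
Variables (X : Type) (R : set (free_group X)).

Definition presented_class (a : free_group X) : presented_group R :=
  group_class R a.

Definition presented_gen (x : X) : presented_group R :=
  presented_class (free_group_gen x).

Lemma presented_classM :
  {morph presented_class : a b / (a * b)%g >-> (a * b)%g}.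
Proof. by move=> a b; exact: esym (group_quot_mulE R a b). Qed.

Lemma presented_class1 : presented_class 1%g = 1%g.
Proof. by []. Qed.

Lemma presented_classV : {morph presented_class : a / a^-1%g >-> a^-1%g}.
Proof. by move=> a; exact: esym (group_quot_invE R a). Qed.

Lemma presented_class_prod (I : Type) (r : seq I) (F : I -> free_group X) :
  presented_class (\prod_(i <- r) F i)%g = (\prod_(i <- r) presented_class (F i))%g.
Proof. exact: (big_morph _ presented_classM presented_class1). Qed.

Lemma presented_classXz a n :
  presented_class (expgz a n) = expgz (presented_class a) n.
Proof.
have cX p : presented_class (a ^+ p)%g = (presented_class a ^+ p)%g.
  by elim: p => [|p IHp]; rewrite ?expg0 // !expgS presented_classM IHp.
by case: n => p /=; rewrite ?presented_classV cX.
Qed.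

Lemma presented_classR a b : presented_class [~ a, b]%g =
  [~ presented_class a, presented_class b]%g.
Proof. by rewrite !commgEl /conjg !presented_classM !presented_classV. Qed.

Lemma presented_relator r : R r -> presented_class r = 1%g.
Proof.
move=> Rr; rewrite -presented_class1; apply/group_classP.
rewrite mulg1; have [_ _ NV _] := normal_closure_normal R.
by apply: NV; exact: sub_normal_closure.
Qed.

Lemma presented_ind (P : presented_group R -> Prop) :
  (forall x, P (presented_gen x)) -> P 1%g -> (forall a, P a -> P a^-1%g) ->
  (forall a b, P a -> P b -> P (a * b)%g) -> forall a, P a.
Proof.
move=> Pg P1 PV PM a; have [t ->] := group_class_surj a.
rewrite -[group_class R t]/(presented_class t).
move: t; apply: (free_group_ind (P := P \o presented_class)) => //= [t Pt|s t Ps Pt].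
- by rewrite presented_classV; exact: PV.
- by rewrite presented_classM; exact: PM.
Qed.

(** A homomorphism from the free group to the Heisenberg extension descends once it kills the
    relators. The assumption ranges over all [m] with the given values because [free_quasihom]
    provides [m] only existentially. *)
Lemma presented_quasihom (M : lmodType rat)
    (k : presented_group R -> presented_group R -> M) (v : X -> M) :
  alt_bihom k ->
  (forall m : free_group X -> M,
    quasihom (fun a b => k (presented_class a) (presented_class b)) m ->
    (forall x, m (free_group_gen x) = v x) -> forall r, R r -> m r = 0) ->
  exists q, quasihom k q /\ forall x, q (presented_gen x) = v x.
Proof.
move=> kP relP; have [m [mP mv]] := free_quasihom v presented_classM kP.
have kcP := alt_bihom_comp presented_classM kP.
(* [N] is the kernel of the map [a |-> (presented_class a, m a)] to the Heisenberg extension, hence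
   normal. *)
pose N : set (free_group X) :=
  [set a | presented_class a = 1%g /\ m a = 0].
have NP : is_normal_subgroup N.
  split=> [|a b [ca ma] [cb mb]|a [ca ma]|a b [ca ma]].
  - by split; [exact: presented_class1|exact: quasihom1 kcP mP].
  - split; first by rewrite presented_classM ca cb mulg1.
    by rewrite mP ma mb ca (bihom1l kP) !addr0.
  - split; first by rewrite presented_classV ca invg1.
    by rewrite (quasihomV kcP mP) ma oppr0.
  - split; first by rewrite /conjg !presented_classM presented_classV ca mul1g mulVg.
    rewrite /conjg !mP (quasihomV kcP mP) ma !presented_classM !presented_classV ca mul1g.
    by rewrite add0r (bihom1l kP) addr0 addNr (bihomVl kP) (bihomxx kP) oppr0 addr0.
have cN a b : presented_class a = presented_class b -> m a = m b.
  move=> cab; have [cab1 mab] : N (a^-1 * b)%g.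
    apply: ((group_classP R a b).1 cab N NP) => r Rr.
    by split; [exact: presented_relator | exact: relP mP mv r Rr].
  by rewrite -[b](mulVKg a) mP mab cab1 (bihom1r kP) !addr0.
have reprK' (y : presented_group R) : presented_class (repr y) = y by exact: reprK.
exists (fun y => m (repr y)); split=> [y y'|x]; last by rewrite -mv; apply: cN.
have := mP (repr y) (repr y'); rewrite !reprK' => <-; apply: cN.
by rewrite presented_classM !reprK'.
Qed.

End PresentedGroup.

(** * Quasihomomorphisms on Seifert groups and the Euler number *)

Section SeifertGroup.
Variables (g : nat) (b : int) (s : nat) (alpha beta : 'I_s -> int).
Hypothesis alpha_ge2 : forall j, 2 <= alpha j.

Local Notation G := (seifert_group g b alpha beta).
Local Notation e := (seifert_euler b alpha beta).

Definition seifert_gen_class (u : seifert_gen g s) : G :=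
  presented_gen (@seifert_relators g b s alpha beta) u.

Local Notation x := (fun i => seifert_gen_class (@SeifertX g s i)).
Local Notation y := (fun i => seifert_gen_class (@SeifertY g s i)).
Local Notation z := (fun j => seifert_gen_class (@SeifertZ g s j)).
Local Notation h := (seifert_gen_class (@SeifertH g s)).

Lemma seifert_alpha_neq0 j : (alpha j)%:~R != 0 :> rat.
Proof. by rewrite intr_eq0 gt_eqF // (lt_le_trans _ (alpha_ge2 j)). Qed.

Section Values.
Variables (M : lmodType rat) (k : G -> G -> M).
Hypothesis kP : alt_bihom k.

(** The fiber relator gives [alpha m(z) + beta m(h) = 0], and [alpha] is invertible in [rat]. *)
Lemma seifert_quasihom_z m j : quasihom k m -> k (z j) h = 0 ->
  m (z j) = - ((beta j)%:~R / (alpha j)%:~R) *: m h.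
Proof.
move=> mP kzh; apply: (scalerI (seifert_alpha_neq0 j)).
have := presented_relator (@SeifertFiber g b s alpha beta j).
rewrite presented_classM !presented_classXz => /(congr1 m).
rewrite (quasihom_fiber_relator kP mP) // (quasihom1 kP mP) => /eqP.
rewrite addr_eq0 => /eqP ->; rewrite scalerA mulrN mulrCA divff ?mulr1.
  by rewrite scaleNr.
exact: seifert_alpha_neq0.
Qed.

(** With the values that the fiber relators force on the [z j], the terms in [z j] and [h] of the
    base relator add up to the Euler number times the value at [h]. *)
Lemma seifert_sum_euler (m : M) :
  \sum_(j < s) - ((beta j)%:~R / (alpha j)%:~R) *: m - b%:~R *: m = e *: m.
Proof.
rewrite -scaler_suml -scaleNr -scalerDl; congr (_ *: _).
by rewrite sumrN addrC.
Qed.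

Lemma seifert_quasihom_euler m : quasihom k m ->
  (forall i j, k (z i) (z j) = 0) -> (forall j, k (z j) h = 0) ->
  2 *: (\sum_(i < g) k (x i) (y i)) + e *: m h = 0.
Proof.
move=> mP kzz kzh; have := quasihom1 kP mP.
rewrite -(presented_relator (SeifertBase g b alpha beta)).
rewrite !presented_classM presented_classV presented_classXz !presented_class_prod.
under eq_bigr => i _ do rewrite presented_classR.
rewrite (quasihom_base_relator kP mP) // -seifert_sum_euler addrA; apply: etrans.
by congr (_ + _ - _); apply: eq_bigr => j _; rewrite (seifert_quasihom_z mP).
Qed.

(** The fiber relators dictate the values on the [z j], and the central relators hold because [h]
    lies in the radical of [k]. Only the base relator constrains the remaining values, and it is the
    displayed equation. *)
Lemma seifert_quasihom_ex (vx vy : 'I_g -> M) (t : M) :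
  (forall a, k h a = 0) -> (forall j a, k (z j) a = 0) ->
  2 *: (\sum_(i < g) k (x i) (y i)) + e *: t = 0 ->
  exists q, [/\ quasihom k q, forall i, q (x i) = vx i,
    forall i, q (y i) = vy i & q h = t].
Proof.
move=> kh kz kt.
pose v (u : seifert_gen g s) := match u with
  | SeifertX i => vx i | SeifertY i => vy i
  | SeifertZ j => - ((beta j)%:~R / (alpha j)%:~R) *: t
  | SeifertH => t end.
have [|q [qP qv]] := @presented_quasihom _ (@seifert_relators g b s alpha beta) M k v kP.
  move=> m mP mv r; have kcP := alt_bihom_comp (@presented_classM _ _) kP.
  case=> [w||j].
  - by rewrite (quasihomR kcP mP) kh scaler0.
  - rewrite (quasihom_base_relator kcP mP);
      [|by move=> i j; exact: kz|by move=> j; exact: kz].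
    apply: etrans kt; rewrite -seifert_sum_euler addrA.
    by rewrite !mv; congr (_ + _ - _); apply: eq_bigr => j _; rewrite mv.
  - rewrite (quasihom_fiber_relator kcP mP); last exact: kz.
    rewrite !mv /= scalerA mulrN mulrCA.
    by rewrite divff ?mulr1 ?seifert_alpha_neq0 // scaleNr addNr.
by exists q; split=> // *; exact: qv.
Qed.

End Values.

Lemma alt_bihom0 (H : groupType) (M : lmodType rat) :
  alt_bihom (fun _ _ : H => 0 : M).
Proof. by split=> *; rewrite ?addr0. Qed.

(** Rationally the value at [z j] is a multiple of the value at [h], so [x i], [y i] and [h] suffice
    as generators. *)
Lemma seifert_hom_eq0 (M : lmodType rat) (f : G -> M) :
  {morph f : a b / (a * b)%g >-> a + b} ->
  (forall i, f (x i) = 0) -> (forall i, f (y i) = 0) -> f h = 0 ->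
  forall a, f a = 0.
Proof.
move=> fM fx fy fh.
have kP := alt_bihom0 G M; have fP : quasihom (fun _ _ => 0) f.
  by move=> a c; rewrite fM addr0.
apply: (presented_ind (P := fun a => f a = 0)) => [[i|i|j|]||a fa|a c fa fc].
- exact: fx.
- exact: fy.
- by rewrite (seifert_quasihom_z kP fP) // fh scaler0.
- exact: fh.
- exact: quasihom1 kP fP.
- by rewrite (quasihomV kP fP) fa oppr0.
- by rewrite fM fa fc addr0.
Qed.

(** The case [k = 0] of the Euler relation. *)
Lemma seifert_hom_h (M : lmodType rat) (f : G -> M) :
  {morph f : a c / (a * c)%g >-> a + c} -> e *: f h = 0.
Proof.
move=> fM; have kP := alt_bihom0 G M; have fP : quasihom (fun _ _ => 0) f.
  by move=> a c; rewrite fM addr0.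
have := seifert_quasihom_euler kP fP (fun _ _ => erefl) (fun _ => erefl).
by rewrite big1 // scaler0 add0r.
Qed.

Lemma seifert_central a : (h * a = a * h)%g.
Proof.
have [w ->] := group_class_surj a.
have := presented_relator (@SeifertCentral g b s alpha beta w).
rewrite presented_classR => /eqP; rewrite commgEl /conjg => /eqP E.
have := congr1 (fun c => h * c)%g E; rewrite mulVKg mulg1 => E'.
have := congr1 (fun c => presented_class _ w * c)%g E'; rewrite mulVKg.
exact.
Qed.

End SeifertGroup.

(** * Linear induction principles and maps on free modules and exterior squares *)

Lemma malg_submod (K : choiceType) (W : set {malg rat[K]}) :
  is_submod W -> (forall k, W << k >>) -> forall c, W c.
Proof.
move=> WP Wk c; rewrite [c]monalgE; apply: submod_sum => // k _.
have -> : << c@_k *g k >> = c@_k *: << k >> :> {malg rat[K]}.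
  by apply/malgP => l; rewrite mcoeffZ !mcoeffU mulr_natr.
exact: submodZ.
Qed.

Lemma ext2_submod (V : lmodType rat) (W : set (ext2 V)) :
  is_submod W -> (forall u v, W (wedge u v)) -> forall w, W w.
Proof.
move=> WP Wuv w; rewrite -[w]lreprK.
move: (lrepr w); apply: malg_submod => [|[u v]]; last exact: Wuv.
split=> [|a c d] /=; first by rewrite raddf0; case: WP.
by rewrite lclass_lin; case: WP => _; apply.
Qed.

Lemma linear_fun0 (V W : lmodType rat) (f : V -> W) : linear f -> f 0 = 0.
Proof. by move=> fL; have := fL (-1) 0 0; rewrite !scaleN1r !addNr. Qed.

Lemma eq_linear_submod (V W : lmodType rat) (f g : V -> W) :
  linear f -> linear g -> is_submod [set v | f v = g v].
Proof.
move=> fL gL; split=> [|a u v /= fu fv]; last by rewrite fL gL fu fv.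
by rewrite /= !linear_fun0.
Qed.

Lemma linear_sumZ (V W : lmodType rat) (f : V -> W) (I : Type) (r : seq I)
    (a : I -> rat) (v : I -> V) : linear f ->
  f (\sum_(i <- r) a i *: v i) = \sum_(i <- r) a i *: f (v i).
Proof.
move=> fL; elim: r => [|i r IHr]; last by rewrite !big_cons fL IHr.
by rewrite !big_nil linear_fun0.
Qed.

Lemma linear_fun_sum (V W : lmodType rat) (f : V -> W) (I : Type) (r : seq I)
    (v : I -> V) : linear f ->
  f (\sum_(i <- r) v i) = \sum_(i <- r) f (v i).
Proof.
move=> fL; under eq_bigr do rewrite -[v _]scale1r.
by rewrite linear_sumZ //; apply: eq_bigr => i _; rewrite scale1r.
Qed.

Lemma alternating_anti (V W : lmodType rat) (B : V -> V -> W) :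
  is_alternating B -> forall u v, B u v = - B v u.
Proof.
move=> [Bl Br B0] u v; apply/eqP; rewrite -addr_eq0; apply/eqP.
have := B0 (u + v); have := Bl (u + v) 1 u v; rewrite !scale1r => ->.
have := Br u 1 u v; rewrite !scale1r => ->; have := Br v 1 u v; rewrite !scale1r => ->.
by rewrite !B0 add0r addr0.
Qed.

(** * Classes of group elements in first homology *)

Section GroupHomologyClasses.
Variable G : groupType.
Local Notation H1 := (homology1 G).

Lemma hom_cocycle (f : G -> rat^o) :
  {morph f : a b / (a * b)%g >-> a + b} -> f \in kerp (@cobd1 G).
Proof.
move=> fM; apply/eqP/funext => -[a b].
by rewrite /= /cobd1_fun /= fM addrAC [f b + _]addrC subrr.
Qed.

Definition coh1 (f : ker (@cobd1 G)) : cohomology1 G := lclass _ f.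

Lemma coh1_surj (x : cohomology1 G) : exists f, x = coh1 f.
Proof. by exists (lrepr x); rewrite /coh1 lreprK. Qed.

Fact chain1_cycle (c : {malg rat[G]}) : c \in kerp (@bd1 G).
Proof. exact: eqxx. Qed.

Definition hclass (c : {malg rat[G]}) : H1 := lclass _ (Ker (chain1_cycle c)).

Definition gclass (a : G) : H1 := hclass << a >>.

Lemma hclass_linear : linear hclass.
Proof.
by move=> a c d; rewrite /hclass -lclass_lin; congr lclass; apply: ker_inj.
Qed.

HB.instance Definition _ := GRing.isLinear.Build rat {malg rat[G]} H1 _
  hclass hclass_linear.

Lemma kron1_gclass f a : kron1 (coh1 f) (gclass a) = ker_val f a.
Proof. by rewrite kron1_class lextU. Qed.

Lemma gclassM : {morph gclass : a b / (a * b)%g >-> a + b}.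
Proof.
move=> a b; apply/eqP; rewrite eq_sym -subr_eq0.
have -> : gclass a + gclass b - gclass (a * b)%g =
    hclass (<< a >> + << b >> - << (a * b)%g >>) by rewrite linearB linearD.
apply/eqP; apply: lclass0; apply: sub_lspan; exists << (a, b) >>.
by rewrite /= lextU /= [RHS]addrC addrA.
Qed.

Lemma gclass_span (W : set H1) :
  is_submod W -> (forall a, W (gclass a)) -> forall z, W z.
Proof.
move=> WP Wa z; rewrite -[z]lreprK.
have -> : lclass _ (lrepr z) = hclass (ker_val (lrepr z)).
  by congr lclass; apply: ker_inj.
move: (ker_val _); apply: malg_submod => [|a]; last exact: Wa.
split=> [|a c d] /=; last by rewrite hclass_linear; case: WP => _; apply.
by rewrite raddf0; case: WP.
Qed.

End GroupHomologyClasses.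

(** The trailing [0] gives both summands the shape [a *: u + v] to which [lclass_lin] and
    [ker_val_lin] apply. *)
Lemma lclass_comb0 (V : lmodType rat) (S : set V) a b (u v : V) :
  lspan S (a *: u + (b *: v + 0)) -> a *: lclass S u + b *: lclass S v = 0.
Proof. by move=> /lclass0; rewrite !lclass_lin raddf0 addr0. Qed.

(** * The dual of the cup product, tori, and vanishing of cup products *)

Section CupDual.
Variable G : groupType.
Local Notation H1 := (homology1 G).
Local Notation H2 := (homology2 G).
Implicit Types f g : ker (@cobd1 G).

Lemma kron2_linearl (c : H2) : linear (fun x : cohomology2 G => kron2 x c).
Proof.
move=> a x y /=; rewrite -(lreprK x) -(lreprK y) -(lreprK c).
rewrite -lclass_lin !kron2_class ker_val_lin; exact: lext_funP.
Qed.

Lemma kron2_cup f g (c : ker (@bd2 G)) :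
  kron2 (cup (coh1 f) (coh1 g)) (lclass _ c) =
  lext (cup_cochain (ker_val f) (ker_val g)) (ker_val c).
Proof. by rewrite cup_class kron2_class. Qed.

Lemma ext2_kron_alternatingl (w : ext2 H1) :
  is_alternating (fun x y : cohomology1 G => ext2_lift (fun u v =>
    kron1 x u * kron1 y v - kron1 x v * kron1 y u : rat^o) w).
Proof.
(* [ext2_lift] evaluates the form on a chosen representative of [v], so it is linear in the form. *)
have linE (B B' : H1 -> H1 -> rat^o) a v :
    ext2_lift (fun u v => a *: B u v + B' u v) v =
    a *: ext2_lift B v + ext2_lift B' v.
  by rewrite /ext2_lift -lext_funP; congr lext; apply/funext => p.
split=> [h a f1 f2|h a f1 f2|h].
- rewrite -linE; congr ext2_lift; apply/funext => u; apply/funext => v.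
  by rewrite !kron1_linearl /GRing.scale /=; ring.
- rewrite -linE; congr ext2_lift; apply/funext => u; apply/funext => v.
  by rewrite !kron1_linearl /GRing.scale /=; ring.
- rewrite /ext2_lift /lext big1 // => p _.
  by rewrite [kron1 h p.1 * _]mulrC subrr scaler0.
Qed.

Lemma ext2_kron_linearl (w : ext2 H1) :
  linear (fun x : ext2 (cohomology1 G) => ext2_kron x w).
Proof. exact: ext2_lift_linear (ext2_kron_alternatingl w). Qed.

Lemma ext2_kron_linearr (x y : cohomology1 G) :
  linear (fun w : ext2 H1 => ext2_kron (wedge x y) w).
Proof.
move=> a u v; rewrite /ext2_kron.
rewrite !ext2_lift_wedge; try exact: ext2_kron_alternatingl.
exact: (ext2_lift_linear (ext2_kron_alternating x y)).
Qed.

(** Both sides of the duality condition are linear in the class that is paired, so wedges of classes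
    of cocycles suffice. *)
Lemma is_cup2_dualP (c : H2) (w : ext2 H1) :
  (forall f g, ext2_kron (wedge (coh1 f) (coh1 g)) w
     = kron2 (cup (coh1 f) (coh1 g)) c) ->
  is_cup2_dual c w.
Proof.
move=> fgP; apply: ext2_submod => [|x y]; last first.
  have [f ->] := coh1_surj x; have [g ->] := coh1_surj y.
  by rewrite /cup2 ext2_lift_wedge //; exact: cup_alternating.
apply: eq_linear_submod; first exact: ext2_kron_linearl.
move=> a x y; rewrite -kron2_linearl; congr kron2.
exact: (ext2_lift_linear (@cup_alternating G)).
Qed.

Lemma is_cup2_dual_wedge (c : H2) (w : ext2 H1) f g : is_cup2_dual c w ->
  ext2_kron (wedge (coh1 f) (coh1 g)) w = kron2 (cup (coh1 f) (coh1 g)) c.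
Proof.
by move=> ->; rewrite /cup2 ext2_lift_wedge //; exact: cup_alternating.
Qed.

Lemma ext2_kron_gclass f g a b :
  ext2_kron (wedge (coh1 f) (coh1 g)) (wedge (gclass a) (gclass b)) =
  ker_val f a * ker_val g b - ker_val f b * ker_val g a.
Proof. by rewrite ext2_kron_wedge !kron1_gclass. Qed.

(** Summing over all ordered pairs avoids choosing an order on [I]; each unordered pair then counts
    twice, whence the factor 2. *)
Lemma ext2_expand (I : finType) (f : I -> ker (@cobd1 G)) (v : I -> H1) :
  (forall z, z = \sum_i kron1 (coh1 (f i)) z *: v i) ->
  forall w : ext2 H1, 2 *: w = \sum_i \sum_j
    ext2_kron (wedge (coh1 (f i)) (coh1 (f j))) w *: wedge (v i) (v j).
Proof.
move=> vf; apply: ext2_submod => [|a b].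
  apply: eq_linear_submod => [c u w|c u w]; first by rewrite scalerDr !scalerA mulrC.
  rewrite scaler_sumr -big_split; apply: eq_bigr => i _ /=.
  rewrite scaler_sumr -big_split; apply: eq_bigr => j _ /=.
  by rewrite ext2_kron_linearr scalerDl scalerA.
have [wl wr w0] := @wedge_alternating H1.
have wE c d : wedge c d = \sum_i \sum_j
    (kron1 (coh1 (f i)) c * kron1 (coh1 (f j)) d) *: wedge (v i) (v j).
  rewrite {1}[c]vf (linear_sumZ _ _ _ (wl d)); apply: eq_bigr => i _.
  rewrite {1}[d]vf (linear_sumZ _ _ _ (wr (v i))) scaler_sumr.
  by apply: eq_bigr => j _; rewrite scalerA.
(* Antisymmetrising turns the coefficients into the determinants computed by [ext2_kron]. *)
have E : 2 *: wedge a b = wedge a b - wedge b a.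
  rewrite [wedge b a](alternating_anti (@wedge_alternating H1)) opprK.
  by rewrite scaler_nat mulr2n.
rewrite /= E (wE a b) (wE b a) -sumrB; apply: eq_bigr => i _.
rewrite -sumrB; apply: eq_bigr => j _; rewrite -scalerBl -(wE a b).
by rewrite ext2_kron_wedge.
Qed.

(** In the bar complex this chain is the fundamental cycle of the torus spanned by the commuting
    pair. *)
Lemma commuting_cycle a b : (a * b = b * a)%g ->
  (<< (a, b) >> - << (b, a) >> : {malg rat[(G * G)%type]}) \in kerp (@bd2 G).
Proof.
move=> ab; rewrite inE linearB /= !lextU /= ab; apply/eqP.
by rewrite [X in X - _]addrAC [_ + << a >>]addrC addrAC subrr.
Qed.

Lemma commuting_cup2_dual a b : (a * b = b * a)%g ->
  exists c : H2, is_cup2_dual c (wedge (gclass a) (gclass b)).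
Proof.
move=> ab; exists (lclass _ (Ker (commuting_cycle ab))).
apply: is_cup2_dualP => f g; rewrite kron2_cup ext2_kron_gclass.
by rewrite linearB /= !lextU /cup_cochain /= mulrC [_ * ker_val g a]mulrC mulrC.
Qed.

(** Up to a coboundary, [f \cup g] is half the alternating cocycle
    [f a * g b - f b * g a]. *)

Lemma quasihom_cup (t t' : rat) f g f' g' (q : G -> rat^o) :
  quasihom (fun a b =>
    t *: (ker_val f a * ker_val g b - ker_val f b * ker_val g a)
    - t' *: (ker_val f' a * ker_val g' b - ker_val f' b * ker_val g' a)) q ->
  t *: cup (coh1 f) (coh1 g) = t' *: cup (coh1 f') (coh1 g').
Proof.
move=> qP; apply/eqP; rewrite -subr_eq0 -scaleNr addrC /coh1 !cup_class.
apply/eqP; apply: lclass_comb0; apply: sub_lspan.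
(* The term in [q] has half the alternating form as coboundary, and the products of cocycles supply
   the symmetric half; together they give the cup product cochains themselves. *)
exists (fun a => - 2^-1 * (q a + (t * (ker_val f a * ker_val g a)
  - t' * (ker_val f' a * ker_val g' a)))).
rewrite !ker_val_lin; apply/funext => -[a c].
rewrite !(addrfctE, scalrfctE) /= /cobd1_fun /cup_cochain /=.
rewrite qP !cocycle1M /GRing.scale /=.
by rewrite -[0 (a, c)]/(0 : rat); field.
Qed.

End CupDual.

(** * Two-cycles obtained from relations between cup product values *)

Section CycleOfRelation.
Variable G : groupType.
Local Notation pairs := (ker (@cobd1 G) * ker (@cobd1 G))%type.
Local Notation target := ({malg rat[G]} * (pairs -> rat^o))%type.

(** Taking values in functions on all pairs of cocycles makes one relation record every cup product
    at once. *)
Definition cup_bihom (a b : G) : pairs -> rat^o := fun p =>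
  ker_val p.1 a * ker_val p.2 b - ker_val p.1 b * ker_val p.2 a.

(** The bar chain [(a, b)] contributes its boundary and its values under all antisymmetrised cup
    products. Hence a vector [(0, phi)] in the span comes from a cycle with values [phi]. *)
Definition cup_relations : set target := [set t | exists a b,
  t = (<< a >> + << b >> - << (a * b)%g >>, cup_bihom a b)].

Definition chain_value (a : G) : lquot cup_relations :=
  lclass cup_relations (<< a >>, 0).

Definition cup_value (phi : pairs -> rat^o) : lquot cup_relations :=
  lclass cup_relations (0, phi).

Lemma cup_value_linear : linear cup_value.
Proof.
move=> a u v; rewrite /cup_value -lclass_lin; congr lclass.
by apply/pair_equal_spec; split=> //=; rewrite scaler0 addr0.
Qed.

HB.instance Definition _ := GRing.isLinear.Build rat (pairs -> rat^o)
  (lquot cup_relations) _ cup_value cup_value_linear.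

Lemma cup_value_bihom : alt_bihom (fun a b => cup_value (cup_bihom a b)).
Proof.
split=> [a b c|a b c|a]; rewrite -?linearD.
- congr cup_value; apply/funext => p; rewrite addrfctE /cup_bihom !cocycle1M.
  by ring.
- congr cup_value; apply/funext => p; rewrite addrfctE /cup_bihom !cocycle1M.
  by ring.
- rewrite (_ : cup_bihom a a = 0) ?raddf0 //; apply/funext => p.
  by rewrite /cup_bihom subrr.
Qed.

Lemma chain_value_quasihom :
  quasihom (fun a b => cup_value (cup_bihom a b)) chain_value.
Proof.
move=> a b; rewrite -[RHS]/(lclass _ _ + lclass _ _ + lclass _ _).
have <- : lclass cup_relations ((<< a >>, 0) + (<< b >>, 0) + (0, cup_bihom a b)) =
    lclass _ (<< a >>, 0) + lclass _ (<< b >>, 0) + lclass _ (0, cup_bihom a b).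
  by rewrite !lclassD.
apply/esym/lclassP; apply: sub_lspan; exists a, b.
by apply/pair_equal_spec; split=> /=; rewrite ?addr0 ?subr0 ?add0r.
Qed.

(** The class of the chain [<< a >>] modulo [cup_relations] is a
    quasihomomorphism in [a], so a relation between values of [cup_bihom] alone
    is realised by a cycle, which the cup products evaluate as in the relation. *)

Lemma cycle_of_relation (phi : pairs -> rat^o) : cup_value phi = 0 ->
  exists c : ker (@bd2 G), forall f g,
    2 * lext (cup_cochain (ker_val f) (ker_val g)) (ker_val c) = phi (f, g).
Proof.
move=> phi0.
have /lclassP : lclass cup_relations (0, phi) = lclass cup_relations 0.
  by rewrite raddf0; exact: phi0.
rewrite subr0.
pose W : set target := [set t | exists c, bd2 G c = t.1 /\ forall f g,
  lext (cup_cochain (ker_val f) (ker_val g)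
        - cup_cochain (ker_val g) (ker_val f) : G * G -> rat^o) c = t.2 (f, g)].
move=> Sphi; have [] : W (0, phi).
  apply: (lspan_min _ _ Sphi) => [|_ [a [b ->]]].
    split=> [|a u v [c [c1 c2]] [d [d1 d2]]].
      by exists 0; split=> [|f g]; rewrite raddf0.
    exists (a *: c + d); split=> [|f g]; first by rewrite linearP c1 d1.
    by rewrite [LHS]linearP /= c2 d2.
  exists << (a, b) >>; split=> [|f g]; rewrite /= lextU /=.
    by rewrite addrAC [<< b >> + _]addrC.
  by rewrite !(addrfctE, opprfctE) /cup_cochain /cup_bihom /=; ring.
move=> c [c0 cphi]; have cK : c \in kerp (bd2 G) by rewrite inE c0.
exists (Ker cK) => f g; rewrite -[RHS]cphi /=.
(* The coboundary of [q] is the symmetric cochain [f(a) g(b) + f(b) g(a)]. It vanishes on the cycle,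
   so twice the cup product and its antisymmetrisation agree there. *)
pose q a : rat^o := - (ker_val f a * ker_val g a).
have : 2 *: cup_cochain (ker_val f) (ker_val g) + 0 = 1 *: (cup_cochain (ker_val f)
    (ker_val g) - cup_cochain (ker_val g) (ker_val f)) + cobd1 G q.
  apply/funext => -[a b]; rewrite !(addrfctE, scalrfctE, opprfctE) /=.
  rewrite /cobd1_fun /cup_cochain /q /= !cocycle1M /GRing.scale /=.
  by rewrite -[0 (a, b)]/(0 : rat); ring.
move/(congr1 (fun F => lext F c)); rewrite !lext_funP lext0l lext_cobd1 c0 raddf0.
by rewrite addr0 scale1r addr0.
Qed.

End CycleOfRelation.

(** * Functoriality of free Lie algebras and comparison of graded quotients *)

Section FreeLieMaps.

Lemma lie_subalgebra (V : lmodType rat) (W : set (lie V)) :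
  is_submod W -> (forall v, W (lie_gen V v)) ->
  (forall u v, W u -> W v -> W (lbr u v)) -> forall u, W u.
Proof.
move=> WP Wg Wbr u; have [t ->] := free_lie_surj u.
elim: t => [v||s Ws t Wt|s Ws|a s Ws|s Ws t Wt].
- exact: Wg.
- by case: WP.
- by rewrite free_lie_classD; exact: submodD.
- have -> : free_lie_class (LieOpp s) = - free_lie_class s.
    exact: esym (free_lie_oppE s).
  exact: submodN.
- by rewrite free_lie_classZ; exact: submodZ.
- by rewrite free_lie_class_br; exact: Wbr.
Qed.

Definition lie_map (V V' : lmodType rat) (f : {linear V -> V'}) :
  {linear lie V -> lie V'} := lie_lift (lie_gen V' \o f).

Lemma lie_map_gen (V V' : lmodType rat) (f : {linear V -> V'}) v :
  lie_map f (lie_gen V v) = lie_gen V' (f v).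
Proof. exact: lie_lift_gen. Qed.

Lemma lie_map_br (V V' : lmodType rat) (f : {linear V -> V'}) u v :
  lie_map f (lbr u v) = lbr (lie_map f u) (lie_map f v).
Proof. exact: lie_lift_br. Qed.

Lemma lie_mapK (V V' : lmodType rat) (f : {linear V -> V'})
    (h : {linear V' -> V}) :
  cancel f h -> cancel (lie_map f) (lie_map h).
Proof.
move=> fK u; move: u.
apply: (lie_subalgebra (W := [set u | lie_map h (lie_map f u) = u])).
- by apply: eq_linear_submod => [a u v|//]; rewrite !linearP.
- by move=> v; rewrite /mkset !lie_map_gen fK.
- by move=> u v; rewrite /mkset !lie_map_br => -> ->.
Qed.

Lemma lie_map_degree (V V' : lmodType rat) (f : {linear V -> V'}) n u :
  lie_degree n u -> lie_degree n (lie_map f u).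
Proof.
move: u; apply: lspan_min => [|u mu].
  have Dsub := lspan_submod (@lie_monomial V' n).
  split=> [|a u v fu fv] /=; first by rewrite raddf0; case: Dsub.
  by rewrite linearP; case: Dsub => _; apply.
apply: sub_lspan; elim: mu => [v|i j x y _ IHx _ IHy].
  by rewrite lie_map_gen; exact: LieMonGen.
by rewrite lie_map_br; exact: LieMonBr.
Qed.

Lemma lie_map_degree_image (V V' : lmodType rat) (f : {linear V -> V'})
    (h : {linear V' -> V}) : cancel f h -> cancel h f ->
  forall n, lie_degree (V := V') n = lie_map f @` lie_degree (V := V) n.
Proof.
move=> fK hK n; apply/seteqP; split=> [u du|_ [u du <-]].
  by exists (lie_map h u); [exact: lie_map_degree|exact: lie_mapK].
exact: lie_map_degree.
Qed.

End FreeLieMaps.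

(** Two surjections from one Lie algebra with the same kernel have isomorphic images. Comparing
    ideals in a common source replaces the construction of inverse maps between quotients. *)
Lemma graded_lie_isomorphic_of_ker (L L1 L2 : lieType) (gL : nat -> set L)
    (g1 : grading L1) (g2 : grading L2) (p1 : {linear L -> L1})
    (p2 : {linear L -> L2}) :
  (forall u v, p1 (lbr u v) = lbr (p1 u) (p1 v)) ->
  (forall u v, p2 (lbr u v) = lbr (p2 u) (p2 v)) ->
  (forall y, exists u, p1 u = y) -> (forall y, exists u, p2 u = y) ->
  (forall u, p1 u = 0 <-> p2 u = 0) ->
  (forall n, g1 n = p1 @` gL n) -> (forall n, g2 n = p2 @` gL n) ->
  graded_lie_isomorphic g1 g2.
Proof.
move=> br1 br2 surj1 surj2 eqker im1 im2.
(* These sections are merely set-theoretic; equality of the kernels makes [phi] independent of their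
   choice. *)
pose s1 y := projT1 (cid (surj1 y)); pose s2 y := projT1 (cid (surj2 y)).
have s1K y : p1 (s1 y) = y by rewrite /s1; case: cid.
have s2K y : p2 (s2 y) = y by rewrite /s2; case: cid.
have eq12 u v : p1 u = p1 v <-> p2 u = p2 v.
  have [k1 k2] := eqker (u - v); rewrite !linearB in k1 k2.
  split=> /eqP; rewrite -subr_eq0 => /eqP.
    by move/k1/eqP; rewrite subr_eq0 => /eqP.
  by move/k2/eqP; rewrite subr_eq0 => /eqP.
pose phi y := p2 (s1 y).
have phiE u : phi (p1 u) = p2 u by apply/eq12; rewrite s1K.
have philin : linear phi.
  move=> a x y; rewrite -[x]s1K -[y]s1K -linearP !phiE; exact: linearP.
pose phiL : {linear L1 -> L2} :=
  HB.pack phi (GRing.isLinear.Build rat L1 L2 _ phi philin).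
exists phiL; split.
- exists (fun y => p1 (s2 y)) => y; last by rewrite -[LHS]/(phi _) phiE s2K.
  by rewrite -{2}[y]s1K; apply/eq12; rewrite s2K.
- move=> x y; rewrite -[LHS]/(phi _) -[phiL x]/(phi _) -[phiL y]/(phi _).
  by rewrite -[x]s1K -[y]s1K -br1 !phiE br2.
- move=> n; rewrite im1 im2; apply/seteqP; split=> [_ [_ [u gu <-] <-]|_ [u gu <-]].
    by exists u => //; rewrite -[RHS]/(phi _) phiE.
  by exists (p1 u); [exists u|exact: phiE].
Qed.

Lemma lie_class_eq0 (L : lieType) (S : set L) u :
  lie_class S u = 0 <-> ideal_gen S u.
Proof.
have -> : (lie_class S u = 0) = (lie_class S u = lie_class S 0) by rewrite raddf0.
by rewrite lie_classP subr0.
Qed.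

Lemma ideal_gen_ker (L L' : lieType) (S : set L) (p : {linear L -> L'}) :
  (forall u v, p (lbr u v) = lbr (p u) (p v)) -> (forall r, S r -> p r = 0) ->
  forall u, ideal_gen S u -> p u = 0.
Proof.
move=> pbr pS u Su; apply: (Su [set u | p u = 0]); last exact: pS.
split; first split=> [|a v w /= pv pw]; rewrite /= ?raddf0 //.
  by rewrite linearP pv pw scaler0 addr0.
by move=> v w pv; rewrite /= pbr pv lbr0l.
Qed.

Lemma ext2_lie_linear (V : lmodType rat) : linear (@ext2_lie V).
Proof.
apply: ext2_lift_linear; split=> [w a x y|w a x y|x].
- by rewrite linearP lbrDl lbrZl.
- by rewrite linearP lbrDr lbrZr.
- exact: lbrxx.
Qed.

HB.instance Definition _ (V : lmodType rat) := GRing.isLinear.Build rat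
  (ext2 V) (lie V) _ (@ext2_lie V) (@ext2_lie_linear V).

(** * First homology with a basis of group elements and dual cocycles *)

Section DualBases.
Variables (G : groupType) (I : finType) (e : I -> G) (f : I -> ker (@cobd1 G)).
Hypothesis f_dual : forall i j, ker_val (f i) (e j) = (i == j)%:R.
Hypothesis hom_eq0 : forall D : G -> homology1 G,
  {morph D : a b / (a * b)%g >-> a + b} -> (forall i, D (e i) = 0) ->
  forall a, D a = 0.

(** The difference of the two sides, as a function of a group element, is a homomorphism that
    vanishes on every [e i], so [hom_eq0] kills it; group elements span the homology. *)
Lemma homology1_expand (z : homology1 G) :
  z = \sum_i kron1 (coh1 (f i)) z *: gclass (e i).
Proof.
move: z; apply: (gclass_span (W := [set z : homology1 G |
    z = \sum_i kron1 (coh1 (f i)) z *: gclass (e i)])) => [|a].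
  apply: (@eq_linear_submod (homology1 G) (homology1 G) id) => // c u v.
  rewrite scaler_sumr -big_split; apply: eq_bigr => i _.
  by rewrite kron1_linearr scalerDl scalerA.
apply/eqP; rewrite -subr_eq0; apply/eqP; move: a.
apply: hom_eq0 => [a b|j].
  rewrite addrACA -opprD -big_split gclassM; congr (_ - _).
  apply: eq_bigr => i _; rewrite /= -scalerDl; congr (_ *: _).
  by have := kron1_linearr (coh1 (f i)) 1 (gclass a) (gclass b); rewrite !scale1r.
rewrite (bigD1 j) //= big1 ?addr0 => [|i /negPf ij].
  by rewrite kron1_gclass f_dual eqxx scale1r subrr.
by rewrite kron1_gclass f_dual ij scale0r.
Qed.

Definition basis_coord (z : homology1 G) : {malg rat[I]} :=
  \sum_i kron1 (coh1 (f i)) z *: << i >>.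

Lemma basis_coord_linear : linear basis_coord.
Proof.
move=> c u v; rewrite scaler_sumr -big_split; apply: eq_bigr => i _ /=.
by rewrite kron1_linearr scalerDl scalerA.
Qed.

HB.instance Definition _ := GRing.isLinear.Build rat (homology1 G)
  {malg rat[I]} _ basis_coord basis_coord_linear.

Definition basis_comb : {linear {malg rat[I]} -> homology1 G} :=
  lext (fun i => gclass (e i)).

Lemma basis_combU i : basis_comb << i >> = gclass (e i).
Proof. exact: lextU. Qed.

Lemma basis_coord_gclass i : basis_coord (gclass (e i)) = << i >>.
Proof.
rewrite /basis_coord (bigD1 i) //= big1 ?addr0 => [|j /negPf ij].
  by rewrite kron1_gclass f_dual eqxx scale1r.
by rewrite kron1_gclass f_dual ij scale0r.
Qed.

Lemma basis_coordK : cancel basis_coord basis_comb.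
Proof.
move=> z; rewrite [RHS]homology1_expand /basis_coord linear_sumZ; last exact: linearP.
by apply: eq_bigr => i _; rewrite basis_combU.
Qed.

Lemma basis_combK : cancel basis_comb basis_coord.
Proof.
move=> c; move: c; apply: (malg_submod (W := [set c | basis_coord (basis_comb c) = c])).
  by apply: eq_linear_submod => [a u v|//]; rewrite !linearP.
by move=> i; rewrite /mkset basis_combU basis_coord_gclass.
Qed.

Lemma lie_map_comb_var i : lie_map basis_comb (lie_var i) = lie_gen _ (gclass (e i)).
Proof. by rewrite /lie_var lie_map_gen basis_combU. Qed.

Lemma lie_map_coord_gclass i :
  lie_map basis_coord (lie_gen _ (gclass (e i))) = lie_var i.
Proof. by rewrite lie_map_gen /= basis_coord_gclass. Qed.

Lemma is_cup2_dual_expand c w : is_cup2_dual c w ->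
  2 *: w = \sum_i \sum_j kron2 (cup (coh1 (f i)) (coh1 (f j))) c
    *: wedge (gclass (e i)) (gclass (e j)).
Proof.
move=> cw; rewrite (ext2_expand homology1_expand); apply: eq_bigr => i _.
by apply: eq_bigr => j _; rewrite (is_cup2_dual_wedge (f i) (f j) cw).
Qed.

Lemma lie_map_coord_degree n : lie_degree (V := {malg rat[I]}) n =
  lie_map basis_coord @` lie_degree (V := homology1 G) n.
Proof. exact: lie_map_degree_image basis_coordK basis_combK n. Qed.

(** If the cup products of the dual classes vanish, the expansion of any dual element [w] is zero,
    so every holonomy relator is zero. *)
Lemma holonomy_free : (forall i j, cup (coh1 (f i)) (coh1 (f j)) = 0) ->
  graded_lie_isomorphic (holonomy_grading G) (lie_on_grading I).
Proof.
move=> cup0; pose p2 := lie_map basis_coord.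
have p2K : cancel p2 (lie_map basis_comb) by exact: lie_mapK basis_coordK.
have rels0 r : @holonomy_rels G r -> r = 0.
  case=> c [w [cw ->]]; suff -> : w = 0 by rewrite raddf0.
  have nz2 : 2 != 0 :> rat by [].
  apply: (scalerI nz2); rewrite scaler0 (is_cup2_dual_expand cw).
  rewrite big1 // => i _; rewrite big1 // => j _; rewrite cup0.
  by rewrite (linear_fun0 (kron2_linearl c)) scale0r.
apply: (@graded_lie_isomorphic_of_ker (lie (homology1 G)) _ _
  (lie_grading (homology1 G)) _ _ (lie_class _) p2) => //.
- exact: lie_class_br.
- exact: lie_map_br.
- by move=> y; have [u ->] := lie_class_surj y; exists u.
- by move=> y; exists (lie_map basis_comb y); exact: (lie_mapK basis_combK).
- move=> u; rewrite lie_class_eq0; split=> [|p20].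
    by apply: ideal_gen_ker => [|r /rels0->]; [exact: lie_map_br|exact: raddf0].
  by rewrite -[u]p2K p20 raddf0; case: (ideal_gen_ideal (@holonomy_rels G)) => -[].
- exact: lie_map_coord_degree.
Qed.

End DualBases.

(** * Cocycles and cup products of Seifert groups *)

Section SeifertHolonomy.
Variables (g : nat) (b : int) (s : nat) (alpha beta : 'I_s -> int).
Hypothesis alpha_ge2 : forall j, 2 <= alpha j.

Local Notation G := (seifert_group g b alpha beta).
Local Notation e := (seifert_euler b alpha beta).
Local Notation gen u := (@seifert_gen_class g b s alpha beta u).
Local Notation x i := (gen (@SeifertX g s i)).
Local Notation y i := (gen (@SeifertY g s i)).
Local Notation z j := (gen (@SeifertZ g s j)).
Local Notation h := (gen (@SeifertH g s)).
Implicit Types f : ker (@cobd1 G).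

Lemma cocycle_z f j :
  ker_val f (z j) = - ((beta j)%:~R / (alpha j)%:~R) * ker_val f h.
Proof.
have kP := alt_bihom0 G rat^o.
have fP : quasihom (fun _ _ : G => 0 : rat^o) (ker_val f).
  by move=> a c; rewrite cocycle1M addr0.
exact: (seifert_quasihom_z alpha_ge2 kP fP).
Qed.

Lemma cocycle_ex (vx vy : 'I_g -> rat) (t : rat) : e * t = 0 ->
  exists f, [/\ forall i, ker_val f (x i) = vx i,
    forall i, ker_val f (y i) = vy i & ker_val f h = t].
Proof.
move=> et; have kP := alt_bihom0 G rat^o.
have [//|//||q [qP qx qy qh]] :=
  @seifert_quasihom_ex g b s alpha beta alpha_ge2 rat^o _ kP vx vy t.
  by rewrite big1 // scaler0 add0r.
have qM : q \in kerp (@cobd1 G).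
  by apply: hom_cocycle => a c; rewrite qP addr0.
by exists (Ker qM).
Qed.

(** Cocycles that vanish on [h] vanish on every [z j], so [h] and the [z j] lie in the radical of
    the difference form. The assumption is the base relator equation for a quasihomomorphism with
    value [u] at [h], which bounds the difference of the cup products. *)
Lemma seifert_cup_eq (t t' u : rat) f1 f2 f3 f4 :
  ker_val f1 h = 0 -> ker_val f2 h = 0 -> ker_val f3 h = 0 -> ker_val f4 h = 0 ->
  2 * (\sum_(i < g)
    (t * (ker_val f1 (x i) * ker_val f2 (y i) - ker_val f1 (y i) * ker_val f2 (x i))
   - t' * (ker_val f3 (x i) * ker_val f4 (y i) - ker_val f3 (y i) * ker_val f4 (x i))))
    + e * u = 0 ->
  t *: cup (coh1 f1) (coh1 f2) = t' *: cup (coh1 f3) (coh1 f4).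
Proof.
move=> h1 h2 h3 h4 sum0.
pose k (a c : G) : rat^o :=
  t *: (ker_val f1 a * ker_val f2 c - ker_val f1 c * ker_val f2 a)
  - t' *: (ker_val f3 a * ker_val f4 c - ker_val f3 c * ker_val f4 a).
have kP : alt_bihom k.
  split=> [a c d|a c d|a]; rewrite /k ?cocycle1M /GRing.scale /=; ring.
have kh a : k h a = 0.
  by rewrite /k h1 h2 h3 h4 !(mul0r, mulr0) subrr !scaler0 subrr.
have kz j a : k (z j) a = 0.
  by rewrite /k !cocycle_z h1 h2 h3 h4 !(mul0r, mulr0) subrr !scaler0 subrr.
have [q [qP _ _ _]] := seifert_quasihom_ex alpha_ge2 kP (fun=> 0) (fun=> 0) kh kz sum0.
exact: quasihom_cup qP.
Qed.

(** * Nonzero Euler number *)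

Section NonzeroEuler.
Hypothesis e_neq0 : e <> 0.

Let gens (k : 'I_g + 'I_g) : G := match k with inl i => x i | inr i => y i end.

Lemma nonzero_euler_h (M : lmodType rat) (D : G -> M) :
  {morph D : a c / (a * c)%g >-> a + c} -> D h = 0.
Proof.
move=> DM; apply/eqP; have /eqP := seifert_hom_h alpha_ge2 DM.
by rewrite scaler_eq0 => /orP[/eqP|].
Qed.

Lemma holonomy_nonzero_euler :
  graded_lie_isomorphic (holonomy_grading G) (lie_on_grading (surface_gen g)).
Proof.
have /choice [f fP] (k : 'I_g + 'I_g) :
    exists f, forall l, ker_val f (gens l) = (k == l)%:R.
  have [|f [fx fy _]] :=
    @cocycle_ex (fun i => (k == inl i)%:R) (fun i => (k == inr i)%:R) 0.
    by rewrite mulr0.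
  by exists f => -[i|i]; [exact: fx|exact: fy].
apply: (@holonomy_free G ('I_g + 'I_g)%type gens f fP) => [D DM De|k l].
  apply: (seifert_hom_eq0 alpha_ge2 DM) => [i|i|]; first exact: (De (inl i)).
    exact: (De (inr i)).
  exact: nonzero_euler_h DM.
have fh m : ker_val (f m) h = 0 by apply: nonzero_euler_h; exact: cocycle1M.
(* Vanishing is the case [t = 1], [t' = 0] of [seifert_cup_eq]. *)
rewrite -[LHS]scale1r -[RHS](scale0r (cup (coh1 (f k)) (coh1 (f l)))).
set S : rat := \sum_(i < g) (1 *
  (ker_val (f k) (x i) * ker_val (f l) (y i)
   - ker_val (f k) (y i) * ker_val (f l) (x i))
  - 0 * (ker_val (f k) (x i) * ker_val (f l) (y i)
   - ker_val (f k) (y i) * ker_val (f l) (x i))).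
(* As [e] is invertible, this value at [h] solves the base equation whatever the sum [S]. *)
apply: (seifert_cup_eq (u := - (2 * S) / e)); rewrite ?fh //.
rewrite mulrCA divff ?mulr1; last exact/eqP.
exact: subrr.
Qed.

End NonzeroEuler.

(** The Euler relation for [chain_value] loses its [h] term when [e = 0]. What remains is a relation
    between values of [cup_bihom] alone, which [cycle_of_relation] realises by a cycle. *)
Lemma base_cup2_dual : e = 0 -> exists c : homology2 G,
  is_cup2_dual c (\sum_(i < g) wedge (gclass (x i)) (gclass (y i))).
Proof.
move=> e0; have kP := @cup_value_bihom G.
(* Every cocycle takes at each [z j] a fixed multiple of its value at [h], so the forms on pairs
   among these elements vanish. *)
have k0 a r r' d : (forall f, ker_val f a = r * ker_val f h) ->
    (forall f, ker_val f d = r' * ker_val f h) -> cup_value (cup_bihom a d) = 0.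
  move=> ar dr; rewrite (_ : cup_bihom a d = 0) ?raddf0 //; apply/funext => p.
  by rewrite /cup_bihom !ar !dr -[RHS]/(0 : rat); ring.
have hr f : ker_val f h = 1 * ker_val f h by rewrite mul1r.
have sum0 := seifert_quasihom_euler alpha_ge2 kP (@chain_value_quasihom G)
  (fun i j => k0 _ _ _ _ (cocycle_z^~ i) (cocycle_z^~ j))
  (fun j => k0 _ _ _ _ (cocycle_z^~ j) hr).
have [|c cP] := @cycle_of_relation G (2 *: \sum_(i < g) cup_bihom (x i) (y i)).
  rewrite linearZ linear_sum /=; apply: etrans sum0.
  by rewrite e0 scale0r addr0.
exists (lclass _ c); apply: is_cup2_dualP => f1 f2.
have L := ext2_kron_linearr (coh1 f1) (coh1 f2).
rewrite kron2_cup (linear_fun_sum _ _ L).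
have nz2 : 2 != 0 :> rat by [].
apply: (mulfI nz2); rewrite cP scalrfctE; congr (_ * _).
rewrite fct_sumE; apply: eq_bigr => i _.
exact: ext2_kron_gclass.
Qed.

(** * Zero Euler number: comparison of the two sets of relations *)

Section ZeroEuler.
Hypothesis e0 : e = 0.

Local Notation I := (option ('I_g + 'I_g)%type).
Local Notation X i := (Some (inl i) : I).
Local Notation Y i := (Some (inr i) : I).

Let gens (k : I) : G :=
  match k with Some (inl i) => x i | Some (inr i) => y i | None => h end.

Variable f : I -> ker (@cobd1 G).
Hypothesis f_dual : forall k l, ker_val (f k) (gens l) = (k == l)%:R.

(** This is the intersection form of the surface: the value of the pair of dual cocycles on the sum
    of the [x i /\ y i]. *)
Let base_form (k l : I) : rat := \sum_(i < g)
  ((k == X i)%:R * (l == Y i)%:R - (k == Y i)%:R * (l == X i)%:R).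

Lemma base_formXY i : base_form (X i) (Y i) = 1.
Proof.
rewrite /base_form (bigD1 i) //= !eqxx big1 ?addr0 => [|j ij].
  by rewrite mulr1.
have /negPf -> : X i != X j by apply: contra ij => /eqP[->].
by rewrite !mul0r subr0.
Qed.

(** Cross-multiplication by the values of the form makes the sum over the base cancel. The indices
    are of the form [Some] because these cocycles vanish on [h]. *)
Lemma zero_euler_cup u v u' v' :
  base_form (Some u') (Some v') *: cup (coh1 (f (Some u))) (coh1 (f (Some v))) =
  base_form (Some u) (Some v) *: cup (coh1 (f (Some u'))) (coh1 (f (Some v'))).
Proof.
have fh w : ker_val (f (Some w)) h = 0 by exact: (f_dual (Some w) None).
have fx k i : ker_val (f k) (x i) = (k == X i)%:R by exact: (f_dual k (X i)).
have fy k i : ker_val (f k) (y i) = (k == Y i)%:R by exact: (f_dual k (Y i)).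
apply: (seifert_cup_eq (u := 0)); rewrite ?fh // mulr0 addr0.
under eq_bigr do rewrite !fx !fy.
rewrite sumrB -!mulr_sumr -/(base_form (Some u) (Some v)).
by rewrite -/(base_form (Some u') (Some v')) [T in T - _]mulrC subrr mulr0.
Qed.

Lemma zero_euler_pairing (c : homology2 G) : exists t, forall u v,
  kron2 (cup (coh1 (f (Some u))) (coh1 (f (Some v)))) c =
  t * base_form (Some u) (Some v).
Proof.
(* For [g = 0] there are no indices [u], and [0] is an arbitrary witness. Otherwise one pair [x i],
   [y i] has form value 1 and determines the scalar. *)
have [i _|no_i] := pickP 'I_g; last by exists 0 => -[i|i]; have := no_i i.
exists (kron2 (cup (coh1 (f (X i))) (coh1 (f (Y i)))) c) => u v.
have := zero_euler_cup u v (inl i) (inr i); rewrite base_formXY scale1r => ->.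
have := kron2_linearl c (base_form (Some u) (Some v))
  (cup (coh1 (f (X i))) (coh1 (f (Y i)))) 0.
by rewrite (linear_fun0 (kron2_linearl c)) !addr0 mulrC.
Qed.

Lemma sum_delta (M : lmodType rat) (J : finType) (B : J -> J -> M) a d :
  \sum_k \sum_l ((k == a)%:R * (l == d)%:R) *: B k l = B a d.
Proof.
rewrite (bigD1 a) //= [T in _ + T]big1 ?addr0 => [|k /negPf ka].
  rewrite (bigD1 d) //= big1 ?addr0 => [|l /negPf ld].
    by rewrite !eqxx mul1r scale1r.
  by rewrite ld mulr0 scale0r.
by rewrite big1 // => l _; rewrite ka mul0r scale0r.
Qed.

Lemma base_form_sum (M : lmodType rat) (B : I -> I -> M) :
  \sum_k \sum_l base_form k l *: B k l = \sum_(i < g) (B (X i) (Y i) - B (Y i) (X i)).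
Proof.
transitivity (\sum_(i < g) \sum_k \sum_l
    ((k == X i)%:R * (l == Y i)%:R - (k == Y i)%:R * (l == X i)%:R) *: B k l).
  rewrite [RHS]exchange_big; apply: eq_bigr => k _; rewrite [RHS]exchange_big.
  by apply: eq_bigr => l _; rewrite scaler_suml.
apply: eq_bigr => i _; rewrite -(sum_delta B (X i)) -(sum_delta B (Y i)) -sumrB.
by apply: eq_bigr => k _; rewrite -sumrB; apply: eq_bigr => l _; rewrite scalerBl.
Qed.

Local Notation target := (lie_on (surface_gen_h g)).
Let var (k : I) : target := lie_var (k : surface_gen_h g).
Let coord : {linear homology1 G -> {malg rat[surface_gen_h g]}} := basis_coord f.
Let comb : {linear {malg rat[surface_gen_h g]} -> homology1 G} := basis_comb gens.

Let hom_eq0 (M : lmodType rat) (D : G -> M) :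
  {morph D : a c / (a * c)%g >-> a + c} -> (forall k, D (gens k) = 0) ->
  forall a, D a = 0.
Proof.
move=> DM De; apply: (seifert_hom_eq0 alpha_ge2 DM) => [i|i|].
- exact: (De (X i)).
- exact: (De (Y i)).
- exact: (De None).
Qed.

(** In the expansion of [2 *: w], pairs containing [h] map to zero by centrality. The other
    coefficients are a multiple of [base_form], so their sum is a multiple of the surface
    relator. *)
Lemma zero_euler_rels0 r : @holonomy_rels G r ->
  lie_class (@surface_lie_rels g) (lie_map coord r) = 0.
Proof.
case=> c [w [cw ->]]; have [t tP] := zero_euler_pairing c.
pose p : {linear ext2 (homology1 G) -> surface_lie g} :=
  lie_class (@surface_lie_rels g) \o (lie_map coord \o @ext2_lie (homology1 G)).
pose v k : surface_lie g := lie_class (@surface_lie_rels g) (var k).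
have pE k l : p (wedge (gclass (gens k)) (gclass (gens l))) = lbr (v k) (v l).
  rewrite /p /= ext2_lie_wedge lie_map_br lie_class_br.
  by congr (lbr (lie_class _ _) (lie_class _ _));
    exact: (lie_map_coord_gclass f_dual).
have vh u : lbr (v None) u = 0.
  have [u' ->] := lie_class_surj u; rewrite -lie_class_br.
  by apply/lie_class_eq0; apply: sub_ideal_gen; exact: SurfaceCentral.
have vxy : \sum_(i < g) lbr (v (X i)) (v (Y i)) = 0.
  under eq_bigr do rewrite -lie_class_br.
  rewrite -linear_sum; apply/lie_class_eq0; apply: sub_ideal_gen.
  exact: SurfaceSum.
have nz2 : 2 != 0 :> rat by [].
apply: (scalerI nz2); rewrite scaler0.
change (2 *: p w = 0); clearbody p v; rewrite -linearZ.
have pZ a u : p (a *: u) = a *: p u by exact: linearZ.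
have -> := is_cup2_dual_expand f_dual (@hom_eq0 _) cw.
transitivity (t *: \sum_k \sum_l base_form k l *: lbr (v k) (v l)).
  rewrite linear_sum scaler_sumr; apply: eq_bigr => k _.
  rewrite linear_sum scaler_sumr; apply: eq_bigr => l _.
  rewrite [LHS]pZ [T in _ *: T]pE [RHS]scalerA.
  case: k l => [k|] [l|]; rewrite ?vh ?[lbr _ (v None)]lbrC ?vh ?oppr0 ?scaler0 //.
  by rewrite tP.
rewrite base_form_sum sumrB vxy.
under eq_bigr do rewrite lbrC.
by rewrite sumrN vxy oppr0 subrr scaler0.
Qed.

(** The surface relator comes from the cycle of [base_cup2_dual], and the brackets of [h] with
    degree one elements come from tori. The Jacobi identity extends the latter to all elements. *)
Lemma zero_euler_surface_rels r : @surface_lie_rels g r ->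
  ideal_gen (@holonomy_rels G) (lie_map comb r).
Proof.
have [Isub Ibr] := ideal_gen_ideal (@holonomy_rels G).
case=> [|u].
  have [c cP] := base_cup2_dual e0; apply: sub_ideal_gen.
  exists c, (\sum_(i < g) wedge (gclass (x i)) (gclass (y i))); split=> //.
  rewrite !linear_sum; apply: eq_bigr => i _ /=.
  rewrite lie_map_br ext2_lie_wedge.
  congr lbr; [exact: (lie_map_comb_var gens (X i))|].
  exact: (lie_map_comb_var gens (Y i)).
have E : lie_map comb (var None) = lie_gen _ (gclass h).
  exact: (lie_map_comb_var gens None).
rewrite lie_map_br; move: (lie_map comb u); rewrite {}E.
(* The elements that commute with [h] modulo the ideal form a subalgebra, so the generators
   suffice. *)
apply: (lie_subalgebra (W := [set v |
  ideal_gen (@holonomy_rels G) (lbr (lie_gen _ (gclass h)) v)])).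
- split=> [|a v w]; first by rewrite /mkset lbr0r; case: Isub.
  by rewrite /mkset lbrDr lbrZr => hv hw; case: Isub => _; apply.
- move=> v; rewrite /mkset; move: v; apply: (gclass_span (W := [set v |
    ideal_gen (@holonomy_rels G) (lbr (lie_gen _ (gclass h)) (lie_gen _ v))])).
    split=> [|a v w]; first by rewrite /mkset raddf0 lbr0r; case: Isub.
    by rewrite /mkset linearP lbrDr lbrZr => hv hw; case: Isub => _; apply.
  move=> a; rewrite /mkset; apply: sub_ideal_gen.
  have [c cP] := commuting_cup2_dual (seifert_central a).
  by exists c, (wedge (gclass h) (gclass a)); rewrite ext2_lie_wedge.
- move=> v w; rewrite /mkset => hv hw.
  have /eqP := lbr_jacobi (lie_gen _ (gclass h)) v w.
  rewrite -addrA addr_eq0 => /eqP ->; apply: (submodN Isub); apply: (submodD Isub).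
    by rewrite [lbr w _]lbrC lbrNr -lbrC; exact: Ibr.
  by rewrite lbrC; apply: (submodN Isub); exact: Ibr.
Qed.

(** The coordinates identify the two free Lie algebras, and each set of relators lands in the ideal
    generated by the other, so the two quotient maps have the same kernel. *)
Lemma holonomy_zero_euler_of_dual_basis :
  graded_lie_isomorphic (holonomy_grading G) (surface_lie_grading g).
Proof.
pose P := lie_map coord; pose Q := lie_map comb.
have coordK : cancel coord comb := basis_coordK f_dual (@hom_eq0 _).
have combK : cancel comb coord := basis_combK f_dual.
have PK : cancel P Q := lie_mapK coordK.
have QK : cancel Q P := lie_mapK combK.
pose p2 : {linear lie (homology1 G) -> surface_lie g} :=
  lie_class (@surface_lie_rels g) \o P.
apply: (@graded_lie_isomorphic_of_ker (lie (homology1 G)) _ _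
  (lie_grading (homology1 G)) _ _ (lie_class _) p2) => //.
- exact: lie_class_br.
- by move=> u v; rewrite /p2 /= /P lie_map_br lie_class_br.
- by move=> y; have [u ->] := lie_class_surj y; exists u.
- move=> y; have [u ->] := lie_class_surj y.
  by exists (Q u); rewrite /p2 /= QK.
- move=> u; rewrite lie_class_eq0; split.
    apply: ideal_gen_ker => [v w|]; last exact: zero_euler_rels0.
    by rewrite /p2 /= /P lie_map_br lie_class_br.
  move=> /lie_class_eq0 Pu; apply/lie_class_eq0; rewrite -[u]PK; move: Pu.
  pose q := lie_class (@holonomy_rels G) \o Q : {linear _ -> _}.
  apply: (ideal_gen_ker (p := q)) => [v w|r /zero_euler_surface_rels hr].
    by rewrite /q /= /Q lie_map_br lie_class_br.
  exact/lie_class_eq0.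
- move=> n; rewrite -[RHS]image_comp -[P @` _](lie_map_degree_image coordK combK).
  by [].
Qed.

End ZeroEuler.

(** When [e = 0] the value of a cocycle at [h] is unconstrained, so [h] joins the [x i] and [y i] in
    a basis with dual cocycles. *)
Lemma holonomy_zero_euler : e = 0 ->
  graded_lie_isomorphic (holonomy_grading G) (surface_lie_grading g).
Proof.
move=> e0; pose gens (k : option ('I_g + 'I_g)) : G :=
  match k with Some (inl i) => x i | Some (inr i) => y i | None => h end.
have /choice [f fP] (k : option ('I_g + 'I_g)) :
    exists f, forall l, ker_val f (gens l) = (k == l)%:R.
  have [|f [fx fy fh]] := @cocycle_ex (fun i => (k == Some (inl i))%:R)
    (fun i => (k == Some (inr i))%:R) (k == None)%:R.
    by rewrite e0 mul0r.
  by exists f => -[[i|i]|]; [exact: fx|exact: fy|exact: fh].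
exact: (@holonomy_zero_euler_of_dual_basis e0 f fP).
Qed.

End SeifertHolonomy.

Theorem theorem9p1 (g : nat) (b : int) (s : nat) (alpha beta : 'I_s -> int)
    (alpha_ge2 : forall j : 'I_s, 2 <= alpha j)
    (coprime_alpha_beta : forall j : 'I_s, coprimez (alpha j) (beta j)) :
  (seifert_euler b alpha beta = 0 ->
    graded_lie_isomorphic (holonomy_grading (seifert_group g b alpha beta))
      (surface_lie_grading g)) /\
  (seifert_euler b alpha beta <> 0 ->
    graded_lie_isomorphic (holonomy_grading (seifert_group g b alpha beta))
      (lie_on_grading (surface_gen g))).
Proof.
split; first exact: holonomy_zero_euler alpha_ge2.
exact: holonomy_nonzero_euler alpha_ge2.
Qed.
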